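(* Let $W$ be a finite complex reflection group acting on $V=\mathbb{C}^2$, and suppose the basic derivations are $\theta_1=x_1\otimes y_1+x_2\otimes y_2$ and $\theta_2=a\otimes y_1+b\otimes y_2$ with $a,b\in\mathbb{C}[x_1,x_2]$ homogeneous of the same degree. Then the following sets are $S^W$-bases of $(S\otimes\wedge^m V^*\otimes V)^W$ for $m=0,1,2$ respectively: $$\mathcal{B}^{(0)}=\{\theta_1,\theta_2\},\quad \mathcal{B}^{(1)}=\{df_1\,\theta_1,\ df_2\,\theta_1,\ d\theta_1,\ d\theta_2\},\quad \mathcal{B}^{(2)}=\{df_1\,d\theta_1,\ df_2\,d\theta_1\}.$$
   Context: $x_1,x_2$ is a basis of $V^*$ with dual basis $y_1,y_2$ of $V$; $S=\mathbb{C}[x_1,x_2]$ with $W$ acting by substitution and diagonally on tensor products; $S^W=\mathbb{C}[f_1,f_2]$ for homogeneous basic invariants. ''Basic derivations'' means $\{\theta_1,\theta_2\}$ is an $S^W$-basis of $(S\otimes V)^W$. $df=\sum_i\frac{\partial f}{\partial x_i}\otimes x_i$; products are taken in $S\otimes\wedge V^*\otimes V$ viewed as a module over $S\otimes\wedge V^*$; $S\otimes V$ is identified with $S\otimes\wedge^0V^*\otimes V$ and $d(f\otimes\omega\otimes y)=\sum_i\frac{\partial f}{\partial x_i}\otimes(x_i\wedge\omega)\otimes y$.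
   Formalization: It is additionally assumed that W fixes no nonzero vector of V; otherwise θ_2 has degree 0 and dθ_2 = 0, so B^(1) is not a basis (e.g. W = {1, diag(-1,1)}, θ_2 = 1⊗y_2). *)

(* Defs.v *)
From HB Require Import structures.
From mathcomp Require Import all_boot all_order all_algebra all_fingroup.
From mathcomp Require Import mxrepresentation.
From mathcomp Require Import complex mpoly reals.

Set Implicit Arguments.
Unset Strict Implicit.
Unset Printing Implicit Defensive.

Import GRing.Theory.
Local Open Scope ring_scope.

(* V is F^n with basis y_0, ..., y_(n-1), and an element of GL(V) is the      *)
(* n x n matrix A of its action on columns of coordinates in that basis.      *)
(* S = F[x_0, ..., x_(n-1)], where (x_i) is the dual basis, is                *)
(* {mpoly F[n]}.                                                              *)

(* An element of S (x) /\V^*: the value at I is the coefficient, in S, of     *)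
(* x_I = x_(i_1) /\ ... /\ x_(i_m), where i_1 < ... < i_m enumerates I.       *)
(* The regular module {mpoly _}^o makes this type an lmodType over S.         *)
Notation form F n := {ffun {set 'I_n} -> {mpoly F[n]}^o}.

(* An element of S (x) /\V^* (x) V: the value at k is the coefficient, in     *)
(* S (x) /\V^*, of y_k.                                                       *)
Notation formder F n := {ffun 'I_n -> form F n}.

Definition poly_form (F : fieldType) (n : nat) (p : {mpoly F[n]}) : form F n :=
  [ffun I => if I == set0 then p else 0].

(* 1 (x) x_i *)
Definition xform (F : fieldType) (n : nat) (i : 'I_n) : form F n :=
  [ffun I => if I == [set i] then 1 else 0].

(* For disjoint I and J, x_I /\ x_J = (-1)^(inversions I J) x_(I :|: J).      *)
Definition inversions (n : nat) (I J : {set 'I_n}) : nat :=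
  #|[set u : 'I_n * 'I_n | [&& u.1 \in I, u.2 \in J & (u.2 < u.1)%N]]|.

Definition wedge (F : fieldType) (n : nat) (al be : form F n) : form F n :=
  [ffun K : {set 'I_n} => \sum_(I : {set 'I_n} | I \subset K)
     (-1) ^+ inversions I (K :\: I) *
       ((al I : {mpoly F[n]}) * (be (K :\: I) : {mpoly F[n]}))].

(* 1 (x) 1 (x) y_k *)
Definition yder (F : fieldType) (n : nat) (k : 'I_n) : formder F n :=
  [ffun j => if j == k then poly_form 1 else 0].

Definition form_mul (F : fieldType) (n : nat)
    (al : form F n) (om : formder F n) : formder F n :=
  [ffun k => wedge al (om k)].

Definition dpoly (F : fieldType) (n : nat) (f : {mpoly F[n]}) : form F n :=
  \sum_(i < n) f^`M(i) *: xform F i.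

(* d (f (x) w) = \sum_i (d f / d x_i) (x) (x_i /\ w) *)
Definition dform (F : fieldType) (n : nat) (al : form F n) : form F n :=
  \sum_(i < n) wedge (xform F i)
     [ffun I : {set 'I_n} => (al I : {mpoly F[n]})^`M(i)].

Definition dder (F : fieldType) (n : nat) (om : formder F n) : formder F n :=
  [ffun k => dform (om k)].

(* The contragredient action on V^*: (A x_i)(v) = x_i (A^-1 v). *)
Definition act_poly (F : fieldType) (n : nat) (A : 'M[F]_n) (p : {mpoly F[n]}) :
    {mpoly F[n]} :=
  p \mPo [tuple \sum_(j < n) invmx A i j *: 'X_j | i < n].

Definition act_xform (F : fieldType) (n : nat) (A : 'M[F]_n) (i : 'I_n) :
    form F n :=
  \sum_(j < n) (invmx A i j)%:MP_[n] *: xform F j.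

(* enum I lists I in increasing order. *)
Definition act_form (F : fieldType) (n : nat) (A : 'M[F]_n) (al : form F n) :
    form F n :=
  \sum_(I : {set 'I_n}) act_poly A (al I) *:
     \big[@wedge F n / poly_form 1]_(i <- enum I) act_xform A i.

(* A y_j = \sum_k A k j y_k *)
Definition act_formder (F : fieldType) (n : nat) (A : 'M[F]_n)
    (om : formder F n) : formder F n :=
  [ffun k : 'I_n => \sum_(j < n) (A k j)%:MP_[n] *: act_form A (om j)].

(* The space fixed pointwise by A is the kernel of A - 1, so that its         *)
(* codimension is the rank of A - 1.                                          *)
Definition is_reflection (F : fieldType) (n : nat) (A : 'M[F]_n) : bool :=
  \rank (A - 1%:M) == 1%N.

Definition reflection_group (F : fieldType) (gT : finGroupType)
    (W : {group gT}) (n : nat) (rW : mx_representation F W n) : Prop :=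
  mx_faithful rW /\ <<[set g in W | is_reflection (rW g)]>>%g = W.

(* V^W = 0, the convention that W has rank dim V. A nonzero fixed vector v    *)
(* could itself be a basic derivation 1 (x) v, with d (1 (x) v) = 0.          *)
Definition essential (F : fieldType) (gT : finGroupType)
    (W : {group gT}) (n : nat) (rW : mx_representation F W n) : Prop :=
  forall v : 'cV[F]_n, (forall g, g \in W -> rW g *m v = v) -> v = 0.

(* S^W *)
Definition inv_poly (F : fieldType) (gT : finGroupType)
    (W : {group gT}) (n : nat) (rW : mx_representation F W n)
    (p : {mpoly F[n]}) : Prop :=
  forall g, g \in W -> act_poly (rW g) p = p.

(* (S (x) /\^m V^* (x) V)^W *)
Definition inv_formder (F : fieldType) (gT : finGroupType)
    (W : {group gT}) (n : nat) (rW : mx_representation F W n)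
    (m : nat) (om : formder F n) : Prop :=
  (forall k (I : {set 'I_n}), #|I| != m -> om k I = 0) /\
  (forall g, g \in W -> act_formder (rW g) om = om).

Definition basic_invariants (F : fieldType) (gT : finGroupType)
    (W : {group gT}) (n : nat) (rW : mx_representation F W n)
    (f : n.-tuple {mpoly F[n]}) : Prop :=
  [/\ forall i, exists d : nat, tnth f i \is d.-homog,
      forall q : {mpoly F[n]}, q \mPo f = 0 -> q = 0
    & forall p, inv_poly rW p <-> exists q : {mpoly F[n]}, p = q \mPo f].

(* b is a basis of the A-module M, where A is a subring of S and M is an      *)
(* A-submodule of the S-module U.                                             *)
Definition is_basis_over (S : comNzRingType) (U : lmodType S)
    (A : S -> Prop) (M : U -> Prop) (b : seq U) : Prop :=
  [/\ forall i : 'I_(size b), M b`_i,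
      forall c : 'I_(size b) -> S, (forall i, A (c i)) ->
        \sum_(i < size b) c i *: b`_i = 0 -> forall i, c i = 0
    & forall u : U, M u -> exists c : 'I_(size b) -> S,
        (forall i, A (c i)) /\ u = \sum_(i < size b) c i *: b`_i].

(* Main.v *)
(* Contraction with the Euler vector field maps an invariant, that is,        *)
(* W-equivariant, matrix Om (the case m = 1) to a vector c1 theta1 + c2       *)
(* theta2. Subtracting c1 dtheta1 and (c2 / e) dtheta2, where e = deg theta2, *)
(* leaves a matrix that kills (x1, x2), hence has the form u (x) (- x2, x1)   *)
(* where u is a vector field twisted by the determinant. Rotated by a quarter *)
(* turn, such a u is an invariant 1-form; so is an element for m = 2.         *)
(* Everything is thus reduced to Solomon's theorem for 1-forms: df1 and df2   *)
(* form a basis of (S (x) V^* )^W.                                            *)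
(*   By Cramer's rule the latter says that the Jacobian J of f1 and f2        *)
(* divides every polynomial s with g s = det(g) s. This is checked locally at *)
(* each v <> 0. Let r be the order of the stabilizer W_v and lam the linear   *)
(* form vanishing at v. On the one hand lam^(r-1) divides s, because det is   *)
(* injective on W_v. On the other hand let P(T) be the product of the T -     *)
(* gamma over the W-orbit of a linear form q; its coefficients are            *)
(* polynomials in f1 and f2, so that differentiating P(q) = 0 gives P'(q) dq  *)
(* in S df1 + S df2. Taking for q the form <-, v>, where <-, -> is a          *)
(* W-invariant Hermitian form, and then a generic perturbation of it along    *)
(* lam, one finds that J divides the product of lam^(r-1) and linear forms    *)
(* that do not vanish at v.                                                   *)

Require Import Defs.
From HB Require Import structures.
From mathcomp Require Import all_boot all_order all_algebra all_fingroup.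
From mathcomp Require Import mxrepresentation.
From mathcomp Require Import complex mpoly reals.
From mathcomp Require Import ring.

Set Implicit Arguments.
Unset Strict Implicit.
Unset Printing Implicit Defensive.

Import GRing.Theory Num.Theory.
Local Open Scope ring_scope.

(** * Linear forms and substitutions *)

(** All three bases rest on [invariant_1form_span] and [d_free]: df1 and df2 freely generate the
    invariant 1-forms. By Cramer's rule this reduces to [jacobian_divides_semi_invariant], which
    [divides_local] assembles from two facts at each nonzero v: [semi_invariant_divides], by which s
    has a high order along the line of v, and [jacobian_local], by which J has no higher one. For m
    = 2, [twisted_rotate] turns coefficient vectors into invariant 1-forms, and df dtheta1 into df.
    For m = 1, spanning is [equivariant_mx_span]. Freeness is [equivariant_mx_free]: contraction
    with the Euler field sends dtheta2 to e theta2 and the other three candidates to invariant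
    multiples of theta1, so the case m = 0 kills the coefficient of dtheta2; the off-diagonal
    entries then give a relation between df1 and df2. *)

Definition divides (S : comNzRingType) (d p : S) : Prop := exists q, p = d * q.

Lemma divides0 (S : comNzRingType) (d : S) : divides d 0.
Proof. by exists 0; rewrite mulr0. Qed.

Lemma dividesD (S : comNzRingType) (d p q : S) :
  divides d p -> divides d q -> divides d (p + q).
Proof. by move=> [p' ->] [q' ->]; exists (p' + q'); rewrite mulrDr. Qed.

Lemma dividesMl (S : comNzRingType) (d p q : S) :
  divides d q -> divides d (p * q).
Proof. by move=> [q' ->]; exists (p * q'); rewrite mulrCA. Qed.

Lemma dividesMr (S : comNzRingType) (d p q : S) :
  divides d p -> divides d (p * q).
Proof. by rewrite mulrC; apply: dividesMl. Qed.

Section LinearForms.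
Context {F : fieldType} {n : nat}.
Implicit Types (r : 'rV[F]_n) (A : 'M[F]_n) (p : {mpoly F[n]}).

Definition linform r : {mpoly F[n]} := \sum_(j < n) r 0 j *: 'X_j.

Fact linform_is_linear : linear linform.
Proof.
move=> c r s; rewrite /linform scaler_sumr -big_split /=.
by apply: eq_bigr => j _; rewrite !mxE scalerDl scalerA.
Qed.
HB.instance Definition _ :=
  GRing.isLinear.Build F 'rV[F]_n {mpoly F[n]} *:%R linform linform_is_linear.

Lemma mderivXU (l i : 'I_n) : ('X_l : {mpoly F[n]})^`M(i) = (l == i)%:R.
Proof.
rewrite mderivX mnm1E; case: eqP => [->|_]; last by rewrite scale0r.
have -> : (U_(i) - U_(i) = 0 :> 'X_{1..n})%MM.
  by apply/mnmP => j; rewrite mnmBE mnm0E subnn.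
by rewrite scale1r mpolyX0.
Qed.

Lemma mderiv_linform r i : (linform r)^`M(i) = (r 0 i)%:MP.
Proof.
rewrite /linform raddf_sum /= (bigD1 i) //= big1 => [|j ij].
  by rewrite mderivZ mderivXU eqxx addr0 -mul_mpolyC mulr1.
by rewrite mderivZ mderivXU (negbTE ij) scaler0.
Qed.

Lemma linform_delta (i : 'I_n) : linform (delta_mx 0 i) = 'X_i.
Proof.
rewrite /linform (bigD1 i) //= mxE !eqxx scale1r big1 ?addr0 // => j ji.
by rewrite mxE (negbTE ji) scale0r.
Qed.

Lemma linform_eq0 r : (linform r == 0) = (r == 0).
Proof.
apply/eqP/eqP => [r0|->]; last by rewrite raddf0.
apply/rowP => j; rewrite mxE; apply/eqP; rewrite -(mpolyC_eq0 n).
by rewrite -mderiv_linform r0 mderiv0.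
Qed.

Lemma comp_linform k r (t : n.-tuple {mpoly F[k]}) :
  linform r \mPo t = \sum_(j < n) r 0 j *: tnth t j.
Proof.
rewrite /linform raddf_sum; apply: eq_bigr => j _.
by rewrite /= comp_mpolyZ comp_mpolyXU -tnth_nth.
Qed.

Lemma act_linform A r : act_poly A (linform r) = linform (r *m invmx A).
Proof.
rewrite /act_poly comp_linform /linform.
under eq_bigr do rewrite tnth_mktuple scaler_sumr.
rewrite exchange_big /=; apply: eq_bigr => j _.
by rewrite mxE scaler_suml; apply: eq_bigr => i _; rewrite scalerA.
Qed.

HB.instance Definition _ A := GRing.RMorphism.copy (act_poly A) (act_poly A).
Lemma act_polyZ A c p : act_poly A (c *: p) = c *: act_poly A p.
Proof. exact: comp_mpolyZ. Qed.

Lemma act_polyC A c : act_poly A c%:MP = c%:MP.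
Proof. exact: comp_mpolyC. Qed.

(** Chain rule. Polynomials satisfying it include constants and variables and are closed under
    products and sums, so induction on monomials suffices. *)
Lemma mderiv_comp k p (t : n.-tuple {mpoly F[k]}) (i : 'I_k) :
  (p \mPo t)^`M(i) = \sum_(j < n) (p^`M(j) \mPo t) * (tnth t j)^`M(i).
Proof.
have prod_rule (q1 q2 : {mpoly F[n]}) :
    (q1 \mPo t)^`M(i) = \sum_(j < n) (q1^`M(j) \mPo t) * (tnth t j)^`M(i) ->
    (q2 \mPo t)^`M(i) = \sum_(j < n) (q2^`M(j) \mPo t) * (tnth t j)^`M(i) ->
    ((q1 * q2) \mPo t)^`M(i)
    = \sum_(j < n) ((q1 * q2)^`M(j) \mPo t) * (tnth t j)^`M(i).
  move=> h1 h2; rewrite rmorphM /= mderivM h1 h2 mulr_suml mulr_sumr -big_split.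
  by apply: eq_bigr => j _ /=; rewrite mderivM rmorphD !rmorphM /=; ring.
have var_rule l : ('X_l \mPo t)^`M(i)
    = \sum_(j < n) (('X_l)^`M(j) \mPo t) * (tnth t j)^`M(i).
  rewrite comp_mpolyXU -tnth_nth (bigD1 l) //= big1 => [|j jl].
    by rewrite mderivXU eqxx comp_mpoly1 mul1r addr0.
  by rewrite mderivXU eq_sym (negbTE jl) comp_mpoly0 mul0r.
have const_rule c : (c%:MP \mPo t)^`M(i)
    = \sum_(j < n) ((c%:MP : {mpoly F[n]})^`M(j) \mPo t) * (tnth t j)^`M(i).
  rewrite comp_mpolyC mderivC big1 // => j _.
  by rewrite mderivC comp_mpoly0 mul0r.
elim/mpolyind: p => [|c m p _ _ IHp].
  by rewrite comp_mpoly0 mderiv0 big1 // => j _; rewrite mderiv0 comp_mpoly0 mul0r.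
rewrite raddfD /= mderivD IHp -mul_mpolyC.
under [RHS]eq_bigr do rewrite mderivD raddfD /= mulrDl.
rewrite big_split /=; congr (_ + _); apply: (prod_rule _ _) => //.
rewrite mpolyXE_id; apply: (big_ind (fun q : {mpoly F[n]} => (q \mPo t)^`M(i)
  = \sum_(j < n) (q^`M(j) \mPo t) * (tnth t j)^`M(i))) => //.
  by rewrite -mpolyC1.
move=> l _; elim: (m l) => [|d IHd]; first by rewrite expr0 -mpolyC1.
by rewrite exprS; apply: (prod_rule _ _).
Qed.

(** Gradients transform as elements of V^*; this is what makes d commute with the action of W. *)
Lemma mderiv_act A p l : (act_poly A p)^`M(l)
  = \sum_i act_poly A (p^`M(i)) * (invmx A i l)%:MP.
Proof.
rewrite mderiv_comp; apply: eq_bigr => i _; rewrite tnth_mktuple.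
have -> : \sum_j invmx A i j *: 'X_j = linform (row i (invmx A)).
  by apply: eq_bigr => j _; rewrite mxE.
by rewrite mderiv_linform mxE.
Qed.

Lemma act_polyX A i : act_poly A 'X_i = \sum_j (invmx A i j)%:MP * 'X_j.
Proof.
rewrite -linform_delta act_linform -rowE.
by apply: eq_bigr => j _; rewrite mxE mul_mpolyC.
Qed.

(** Substitutions congruent modulo d have congruent values; used both for restriction to a line and
    for the action of a stabilizer. *)
Lemma divides_comp k (d : {mpoly F[k]}) p (t u : n.-tuple {mpoly F[k]}) :
  (forall j, divides d (tnth t j - tnth u j)) ->
  divides d ((p \mPo t) - (p \mPo u)).
Proof.
move=> dtu.
have mul_rule (a1 a2 b1 b2 : {mpoly F[k]}) :
    divides d (a1 - b1) -> divides d (a2 - b2) ->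
    divides d (a1 * a2 - b1 * b2).
  move=> d1 d2; have -> : a1 * a2 - b1 * b2 = (a1 - b1) * a2 + b1 * (a2 - b2).
    by ring.
  by apply: dividesD; [apply: dividesMr | apply: dividesMl].
elim/mpolyind: p => [|c m p _ _ IHp].
  by rewrite !comp_mpoly0 subrr; apply: divides0.
rewrite !comp_mpolyD opprD addrACA; apply: dividesD => //.
rewrite !comp_mpolyZ -scalerBr -mul_mpolyC; apply: dividesMl.
rewrite !comp_mpolyX; apply: (big_ind2 (fun a b => divides d (a - b))) => //.
- by rewrite subrr; apply: divides0.
- by move=> a1 a2 b1 b2 h1 h2; apply: (mul_rule _ _ _ _).
move=> j _; elim: (m j) => [|l IHl].
  by rewrite !expr0 subrr; apply: divides0.
by rewrite !exprS; apply: (mul_rule _ _ _ _).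
Qed.

End LinearForms.

(** * Local divisibility in two variables *)

Section Plane.
Context {F : fieldType}.
Implicit Types (r s : 'rV[F]_2) (v w : 'cV[F]_2) (A : 'M[F]_2) (p q : {mpoly F[2]}).

Lemma ord2P (i : 'I_2) : i = 0 \/ i = 1.
Proof.
by case: i => [[|[|m]]] // lt_m; [left | right]; apply: val_inj.
Qed.

Lemma sum_ord2 (V : nmodType) (f : 'I_2 -> V) : \sum_i f i = f 0 + f 1.
Proof.
rewrite !big_ord_recl big_ord0 addr0.
by congr (f _ + f _); apply: val_inj.
Qed.

Lemma det2 A : \det A = A 0 0 * A 1 1 - A 0 1 * A 1 0.
Proof.
rewrite (expand_det_row _ 0) sum_ord2 /cofactor !det_mx11 !mxE /=.
have -> : lift (0 : 'I_2) 0 = 1 by apply: val_inj.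
have -> : lift (1 : 'I_2) 0 = 0 by apply: val_inj.
by rewrite expr0 expr1; ring.
Qed.

(** The linear form w |-> det(v, w), an equation of the line through v. *)
Definition perp v : 'rV[F]_2 := \row_i (if i == 0 then - v 1 0 else v 0 0).

Lemma perp0E v : perp v 0 0 = - v 1 0. Proof. by rewrite mxE. Qed.
Lemma perp1E v : perp v 0 1 = v 0 0. Proof. by rewrite mxE. Qed.

Lemma row2P r s : r 0 0 = s 0 0 -> r 0 1 = s 0 1 -> r = s.
Proof. by move=> r0 r1; apply/rowP => i; case: (ord2P i) => ->. Qed.

Lemma col2P v w : v 0 0 = w 0 0 -> v 1 0 = w 1 0 -> v = w.
Proof. by move=> r0 r1; apply/colP => i; case: (ord2P i) => ->. Qed.

Lemma mul_row_col2 r v : (r *m v) 0 0 = r 0 0 * v 0 0 + r 0 1 * v 1 0.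
Proof. by rewrite mxE sum_ord2. Qed.

Lemma mulmx_eq0 r v : (r *m v == 0) = ((r *m v) 0 0 == 0).
Proof.
apply/eqP/eqP => [->|rv0]; first by rewrite mxE.
by rewrite [_ *m _]mx11_scalar rv0 raddf0.
Qed.

Lemma perp_mul v : perp v *m v = 0.
Proof. by apply/eqP; rewrite mulmx_eq0 mul_row_col2 perp0E perp1E; apply/eqP; ring. Qed.

Lemma perp_eq0 v : (perp v == 0) = (v == 0).
Proof.
apply/eqP/eqP => [pv0|->]; last by apply: row2P; rewrite !mxE ?oppr0.
apply: col2P; rewrite !mxE; first by rewrite -perp1E pv0 mxE.
by apply/eqP; rewrite -oppr_eq0 -perp0E pv0 mxE.
Qed.

Lemma cV2_neq0 v : v != 0 -> exists k, v k 0 != 0.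
Proof.
move=> v0; case: (eqVneq (v 0 0) 0) => [v00|]; last by exists 0.
exists 1; apply: contraNneq v0 => v10; apply/eqP.
by apply: col2P; rewrite mxE.
Qed.

Lemma perp_span r v : v != 0 -> r *m v = 0 -> exists c, r = c *: perp v.
Proof.
move=> v0 /eqP; rewrite mulmx_eq0 mul_row_col2 => /eqP rv.
have [k vk] := cV2_neq0 v0; case: (ord2P k) vk => -> vk.
  exists (r 0 1 / v 0 0); apply: row2P; rewrite !mxE /=; last by field.
  have rv' : r 0 0 * v 0 0 = - (r 0 1 * v 1 0) by apply/eqP; rewrite -addr_eq0 rv.
  by rewrite -[r 0 0](mulfK vk) rv'; field.
exists (- (r 0 0 / v 1 0)); apply: row2P; rewrite !mxE /=; first by field.
have rv' : r 0 1 * v 1 0 = - (r 0 0 * v 0 0).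
  by apply/eqP; rewrite -addr_eq0 addrC rv.
by rewrite -[r 0 1](mulfK vk) rv'; field.
Qed.

(** This is det(Av, Aw) = det(A) det(v, w). *)
Lemma perp_mulmx v A : perp (A *m v) *m A = \det A *: perp v.
Proof.
by apply: row2P; rewrite det2 !(mxE, sum_ord2) /=; ring.
Qed.

Lemma perp_invmx v A : A \in unitmx ->
  perp v *m invmx A = (\det A)^-1 *: perp (A *m v).
Proof.
move=> uA; have dA : \det A != 0 by rewrite -unitfE -unitmxE.
apply: (scalerI dA); rewrite scalerA divff // scale1r scalemxAl -perp_mulmx.
by rewrite mulmxK.
Qed.

Lemma divides_linform v r : v != 0 -> r *m v = 0 ->
  divides (linform (perp v)) (linform r).
Proof.
move=> v0 /(perp_span v0)[c ->]; exists c%:MP.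
by rewrite linearZ /= -mul_mpolyC mulrC.
Qed.

Definition linprod (L : seq 'rV[F]_2) : {mpoly F[2]} := \prod_(r <- L) linform r.

(* The restriction to the line through v is realized inside S, by            *)
(* x_i |-> (v_i / v_k) x_k, which keeps products nonzero.                    *)
Lemma restriction v : v != 0 ->
  exists (k : 'I_2) (rho : {rmorphism {mpoly F[2]} -> {mpoly F[2]}}),
  [/\ v k 0 != 0, forall p, divides (linform (perp v)) (p - rho p),
     rho (linform (perp v)) = 0
   & forall r, rho (linform r) = ((r *m v) 0 0 / v k 0) *: 'X_k].
Proof.
move=> v0; have [k vk] := cV2_neq0 v0.
pose t := [tuple (v i 0 / v k 0) *: ('X_k : {mpoly F[2]}) | i < 2].
have rhoE r : linform r \mPo t = ((r *m v) 0 0 / v k 0) *: 'X_k.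
  rewrite comp_linform mxE mulr_suml scaler_suml; apply: eq_bigr => i _.
  by rewrite tnth_mktuple scalerA mulrA.
exists k, (comp_mpoly t); split=> //; last first.
  by rewrite /= rhoE perp_mul mxE mul0r scale0r.
move=> p; rewrite -{1}[p]comp_mpoly_id; apply: divides_comp => i.
rewrite !tnth_mktuple.
have -> : 'X_i - (v i 0 / v k 0) *: 'X_k
    = linform (delta_mx 0 i - (v i 0 / v k 0) *: delta_mx 0 k).
  by rewrite [RHS]raddfB /= [in RHS]linearZ /= !linform_delta.
apply: divides_linform => //; apply/eqP.
rewrite mulmx_eq0 mulmxBl -scalemxAl -!rowE !mxE.
by rewrite divfK // subrr.
Qed.

(** Restriction to the line of v kills [p * linprod L] but no factor of [linprod L], hence it kills
    p, and p is congruent to its restriction modulo [linform (perp v)]. *)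
Lemma divides_linprod_cancel v p (L : seq 'rV[F]_2) : v != 0 ->
  (forall r, r \in L -> r *m v != 0) ->
  divides (linform (perp v)) (p * linprod L) -> divides (linform (perp v)) p.
Proof.
move=> v0 Lv [q pq]; have [k [rho [vk rhoP rho0 rhoE]]] := restriction v0.
have : rho (p * linprod L) == 0 by rewrite pq rmorphM rho0 mul0r.
rewrite rmorphM mulf_eq0 => /orP[/eqP p0|]; first by rewrite -[p]subr0 -p0.
rewrite rmorph_prod prodf_seq_eq0 => /hasP[r rL /=].
rewrite rhoE -linform_delta -linearZ linform_eq0 scaler_eq0 mulf_eq0 invr_eq0.
rewrite (negbTE vk) orbF -mulmx_eq0 (negbTE (Lv _ rL)) /=.
by move/eqP/rowP/(_ k); rewrite !mxE !eqxx => /eqP; rewrite oner_eq0.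
Qed.

(* Peels the linear factors off one denominator, each one with the help of a *)
(* denominator that does not vanish on its line.                             *)
Lemma divides_local (d p : {mpoly F[2]}) : d != 0 ->
  (forall v, v != 0 -> exists L : seq 'rV[F]_2,
     (forall r, r \in L -> r *m v != 0) /\ divides d (p * linprod L)) ->
  divides d p.
Proof.
move=> d0 loc.
have peel L : (forall r, r \in L -> r != 0) -> divides d (p * linprod L) -> divides d p.
  elim: L => [|r L IHL] L0; first by rewrite /linprod big_nil mulr1.
  move=> [T1 e1]; apply: IHL => [s sL|]; first by apply: L0; rewrite inE sL orbT.
  have r0 : r != 0 by apply: L0; rewrite mem_head.
  (* A vector spanning the zero line of the form r to be removed. *)
  pose v : 'cV[F]_2 := \col_i (if i == 0 then r 0 1 else - r 0 0).
  have vr : perp v = r by apply: row2P; rewrite !mxE //= opprK.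
  have v0 : v != 0 by rewrite -perp_eq0 vr.
  have [L' [L'v [T2 e2]]] := loc v v0.
  have [|T1' e1'] := @divides_linprod_cancel v T1 L' v0 L'v.
    (* Multiplying the two divisibility relations crosswise and cancelling d shows that r divides
       [T1 * linprod L']; since r does not divide [linprod L'], it divides [T1]. *)
    exists (linprod L * T2); apply: (mulfI d0).
    rewrite vr mulrA -e1 /linprod big_cons -/(linprod L) -/(linprod L').
    have -> : d * (linform r * (linprod L * T2)) = linform r * linprod L * (d * T2).
      by ring.
    by rewrite -e2; ring.
  exists T1'; have lr0 : linform r != 0 by rewrite linform_eq0.
  apply: (mulfI lr0); move: e1; rewrite e1' vr /linprod big_cons => e1.
  by rewrite [RHS]mulrCA -e1 mulrCA.
(* Any nonzero vector supplies a denominator from which the peeling can start. *)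
have [|L [Lv dL]] := loc (const_mx 1).
  by apply/eqP => /colP/(_ 0); rewrite !mxE; apply/eqP; rewrite oner_eq0.
by apply: (peel L) => // r /Lv; apply: contraNneq => ->; rewrite mul0mx.
Qed.

End Plane.

(** * The invariant Hermitian form *)

(** The witness exceeds in norm every element of the list; it provides the generic perturbation
    parameter in [jacobian_local]. *)
Lemma exists_notin (C : numDomainType) (s : seq C) : exists c, c \notin s.
Proof.
have norm_le x : x \in s -> `|x| <= \sum_(y <- s) `|y|.
  move=> xs; rewrite (perm_big _ (perm_to_rem xs)) big_cons lerDl.
  exact: sumr_ge0.
exists (1 + \sum_(y <- s) `|y|); apply/negP => /norm_le.
rewrite ger0_norm ?addr_ge0 ?ler01 ?sumr_ge0 // -[leRHS]add0r lerD2r.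
by rewrite ler10.
Qed.

Section InvariantHermitianForm.
Context {C : numClosedFieldType} {gT : finGroupType} {W : {group gT}} {n : nat}.
Variable rW : mx_representation C W n.

Definition hform (u w : 'cV[C]_n) : C :=
  \sum_(g in W) \sum_i (rW g *m u) i 0 * ((rW g *m w) i 0)^*.

Lemma hformBl u1 u2 w : hform (u1 - u2) w = hform u1 w - hform u2 w.
Proof.
rewrite /hform -sumrB; apply: eq_bigr => g _; rewrite -sumrB.
by apply: eq_bigr => i _; rewrite mulmxBr mxE [X in _ + X]mxE mulrBl.
Qed.

Lemma hform_sym u w : hform w u = (hform u w)^*.
Proof.
rewrite /hform rmorph_sum; apply: eq_bigr => g _; rewrite rmorph_sum.
by apply: eq_bigr => i _; rewrite rmorphM /= conjCK mulrC.
Qed.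

Lemma hformBr u w1 w2 : hform u (w1 - w2) = hform u w1 - hform u w2.
Proof. by rewrite hform_sym hformBl rmorphB /= -!hform_sym. Qed.

Lemma hform_invariant h u w : h \in W -> hform (rW h *m u) (rW h *m w) = hform u w.
Proof.
move=> hW; rewrite /hform [RHS](reindex_inj (mulIg h)) /=.
apply: eq_big => g; first by rewrite groupMr.
by move=> gW; apply: eq_bigr => i _; rewrite !mulmxA -repr_mxM.
Qed.

Lemma hform_eq0 u : hform u u = 0 -> u = 0.
Proof.
move=> u0; apply/colP => i; rewrite mxE; apply/eqP.
have nneg g j : 0 <= (rW g *m u) j 0 * ((rW g *m u) j 0)^*.
  exact: mul_conjC_ge0.
have /eqP := u0; rewrite psumr_eq0 => [/allP/(_ 1%g)|g _]; last exact: sumr_ge0.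
rewrite mem_index_enum group1 repr_mx1 mul1mx => /(_ isT).
rewrite psumr_eq0 => [/allP/(_ i)|j _]; last exact: mul_conjC_ge0.
by rewrite mem_index_enum => /(_ isT); rewrite mul_conjC_eq0.
Qed.

(** The form is linear in its first argument, so the functional <-, v> is represented by the row of
    its values on basis vectors. *)
Lemma hform_row v u : (\row_j hform (delta_mx j 0) v) *m u = (hform u v)%:M.
Proof.
rewrite [LHS]mx11_scalar; congr (_%:M); rewrite mxE /hform.
under eq_bigr do rewrite mxE mulr_suml.
rewrite exchange_big; apply: eq_bigr => g _ /=.
under eq_bigr do rewrite mulr_suml.
rewrite exchange_big; apply: eq_bigr => i _ /=.
rewrite [in RHS]mxE mulr_suml; apply: eq_bigr => j _.
by rewrite -colE mxE; ring.
Qed.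

(* Invariance gives the second claim, and the equality case of the           *)
(* Cauchy-Schwarz inequality between v and g v, which have the same norm, the *)
(* third one.                                                                *)
Lemma separating_row (v : 'cV[C]_n) : v != 0 -> exists y : 'rV[C]_n,
  [/\ y *m v != 0,
      forall g, g \in W -> rW g *m v = v -> y *m rW g = y
    & forall g, g \in W -> y *m rW g *m v = y *m v -> rW g *m v = v].
Proof.
move=> v0; exists (\row_j hform (delta_mx j 0) v); split.
- apply: contraNneq v0; rewrite hform_row => /matrixP/(_ 0 0).
  by rewrite !mxE mulr1n => /hform_eq0 ->.
- move=> g gW gv; apply/rowP => j.
  have /matrixP/(_ 0 0) : (\row_j hform (delta_mx j 0) v) *m rW g *m (delta_mx j 0 : 'cV_n)
      = (\row_j hform (delta_mx j 0) v) *m delta_mx j 0.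
    by rewrite -mulmxA !hform_row -{1}gv hform_invariant.
  by rewrite -!colE mxE => ->; rewrite mxE.
move=> g gW; rewrite -mulmxA !hform_row => /matrixP/(_ 0 0).
(* As <gv, v> = <v, v> and g is an isometry, the squared norm of gv - v expands to 0. *)
rewrite !mxE !mulr1n => gv; apply/eqP; rewrite -subr_eq0; apply/eqP/hform_eq0.
rewrite hformBl !hformBr hform_invariant // gv [hform v (_ *m _)]hform_sym gv.
by rewrite -hform_sym !subrr.
Qed.

End InvariantHermitianForm.

(** * The Jacobian of the basic invariants *)

Section Solomon.
Context {C : numClosedFieldType} {gT : finGroupType} {W : {group gT}}.
Variables (rW : mx_representation C W 2) (f1 f2 : {mpoly C[2]}).
Hypothesis invariant_comp : forall p, inv_poly rW p ->
  exists q : {mpoly C[2]}, p = q \mPo [tuple f1; f2].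

Implicit Types (v : 'cV[C]_2) (r : 'rV[C]_2) (g : gT) (p q : {mpoly C[2]}).
Local Notation S := {mpoly C[2]}.
Local Notation act g := (act_poly (rW g)).

Definition in_span_df (h : 'I_2 -> S) :=
  exists A B, forall i, h i = A * f1^`M(i) + B * f2^`M(i).

Definition jacobian : S := f1^`M(0) * f2^`M(1) - f1^`M(1) * f2^`M(0).

(** The wedge of two combinations of df1 and df2 is a multiple of df1 /\ df2. *)
Lemma jacobian_divides h k : in_span_df h -> in_span_df k ->
  divides jacobian (h 0 * k 1 - h 1 * k 0).
Proof.
move=> [A [B hE]] [A' [B' kE]]; exists (A * B' - B * A').
by rewrite !hE !kE /jacobian; ring.
Qed.

Lemma d_invariant p : inv_poly rW p -> in_span_df (fun i => p^`M(i)).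
Proof.
case/invariant_comp => q ->.
exists (q^`M(0) \mPo [tuple f1; f2]), (q^`M(1) \mPo [tuple f1; f2]) => i.
by rewrite mderiv_comp sum_ord2.
Qed.

(** The difference is P with its coefficients differentiated, evaluated at q; these coefficients are
    invariant, so [d_invariant] applies to each. *)
Lemma d_horner (P : {poly S}) (q : S) : (forall k, inv_poly rW P`_k) ->
  in_span_df (fun i => (P.[q])^`M(i) - P^`().[q] * q^`M(i)).
Proof.
elim/poly_ind: P => [|P c IHP] Pinv.
  by exists 0, 0 => i; rewrite deriv0 !horner0 mderiv0 !mul0r subrr addr0.
have [|A [B AB]] := IHP.
  by move=> k; move: (Pinv k.+1); rewrite coefD coefMX coefC addr0.
have [|A' [B' AB']] := @d_invariant c.
  by move: (Pinv 0); rewrite coefD coefMX coefC add0r.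
exists (A * q + A'), (B * q + B') => i.
rewrite derivD derivM derivX derivC addr0 mulr1.
rewrite !(hornerD, hornerMX, hornerC) mderivD AB' mderivM.
have -> : (P.[q])^`M(i) = (A * f1^`M(i) + B * f2^`M(i)) + P^`().[q] * q^`M(i).
  by rewrite -AB subrK.
by ring.
Qed.

(* The polynomial with roots r :: O has invariant coefficients, and r is a   *)
(* simple root when r \notin O.                                              *)
Lemma d_linform_orbit r O :
  (forall g, g \in W -> perm_eq [seq s *m invmx (rW g) | s <- r :: O] (r :: O)) ->
  in_span_df (fun i => linprod [seq r - s | s <- O] * (r 0 i)%:MP).
Proof.
move=> stable; pose P : {poly S} := \prod_(s <- r :: O) ('X - (linform s)%:P).
have Pinv k : inv_poly rW P`_k.
  move=> g gW; rewrite -[LHS]coef_map.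
  suff -> : map_poly (act g) P = P by [].
  rewrite rmorph_prod -[RHS](perm_big _ (stable g gW)) big_map.
  by apply: eq_bigr => s _ /=; rewrite map_polyXsubC /= act_linform.
have [A [B AB]] := d_horner (linform r) Pinv.
exists (- A), (- B) => i; have := AB i.
have -> : P = ('X - (linform r)%:P) * \prod_(s <- O) ('X - (linform s)%:P).
  exact: big_cons.
rewrite derivM derivXsubC mul1r hornerD !hornerM !hornerXsubC subrr !mul0r.
rewrite mderiv0 addr0 sub0r mderiv_linform horner_prod !mulNr -opprD => <-.
rewrite opprK; congr (_ * _); rewrite /linprod big_map; apply: eq_bigr => s _.
by rewrite hornerXsubC -raddfB.
Qed.

Lemma repr_unitmx g : g \in W -> rW g \in unitmx.
Proof. exact: repr_mx_unit. Qed.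

(** Left translation by h permutes W. The orbit is a list indexed by W, repetitions included. *)
Lemma orbit_stable r (h : gT) : h \in W ->
  perm_eq [seq s *m invmx (rW h) | s <- [seq r *m invmx (rW g) | g <- enum W]]
          [seq r *m invmx (rW g) | g <- enum W].
Proof.
move=> hW; rewrite -map_comp.
have -> : [seq r *m invmx (rW g) | g <- enum W]
   = [seq r *m rW (g^-1)%g | g <- enum W].
  by apply/eq_in_map => g; rewrite mem_enum => gW; rewrite repr_mxV.
have eqh : {in enum W, (fun s => s *m invmx (rW h)) \o (fun g => r *m invmx (rW g))
   =1 (fun g => r *m rW (g^-1)%g) \o (fun g => (h * g)%g)}.
  move=> g; rewrite mem_enum => gW /=.
  by rewrite invMg repr_mxM ?groupV // !repr_mxV // mulmxA.
have /eq_in_map eqh' := eqh.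
rewrite {}eqh' map_comp; apply: perm_map; apply: uniq_perm; rewrite ?enum_uniq //.
  by rewrite map_inj_uniq ?enum_uniq //; apply: mulgI.
move=> g; rewrite mem_enum; apply/mapP/idP => [[k]|gW].
  by rewrite mem_enum => kW ->; rewrite groupM.
exists (h^-1 * g)%g; rewrite ?mulKVg // mem_enum groupM ?groupV //.
Qed.

Definition stab (v : 'cV[C]_2) : {set gT} := [set g in W | rW g *m v == v].

Lemma stabP v g : reflect (g \in W /\ rW g *m v = v) (g \in stab v).
Proof. by rewrite inE; apply: (iffP andP) => -[gW /eqP]. Qed.

Lemma invmx_fix v g : g \in W -> (invmx (rW g) *m v == v) = (rW g *m v == v).
Proof.
move=> gW; apply/eqP/eqP => e; first by rewrite -{1}e mulKVmx ?repr_unitmx.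
by rewrite -{1}e mulKmx ?repr_unitmx.
Qed.

Lemma stabW v : stab v \subset W.
Proof. by apply/subsetP => g /stabP[]. Qed.

Lemma stab1 v : 1%g \in stab v.
Proof. by apply/stabP; rewrite group1 repr_mx1 mul1mx. Qed.

(** An element g of the stabilizer fixes the form y of [separating_row] and scales [perp v] by
    det(g)^-1. Since y does not vanish at v, these two forms span V^*, so det(g) determines g. *)
Lemma det_stab_inj v : mx_faithful rW -> v != 0 ->
  {in stab v &, injective (fun g => \det (rW g))}.
Proof.
move=> fW v0 g h /stabP[gW gv] /stabP[hW hv] edet.
have [y [yv yfix _]] := separating_row rW v0.
apply: (mx_faithful_inj fW) => //; apply: (can_inj (@invmxK _ _)).
have yV k : k \in W -> rW k *m v = v -> y *m invmx (rW k) = y.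
  by move=> kW kv; rewrite -{1}(yfix k kW kv) mulmxK ?repr_unitmx.
have vV k : k \in W -> rW k *m v = v ->
    perp v *m invmx (rW k) = (\det (rW k))^-1 *: perp v.
  by move=> kW kv; rewrite perp_invmx ?repr_unitmx // kv.
(* Naming this 1 x 1 matrix keeps [mxE] from expanding the product. *)
have [w yvE] : exists w, y *m v = w by exists (y *m v).
have w0 : w 0 0 != 0 by rewrite -yvE -mulmx_eq0.
apply/row_matrixP => i; rewrite !rowE.
have [|c e] := @perp_span C (delta_mx 0 i - (v i 0 / w 0 0) *: y) v v0.
  apply/eqP; rewrite mulmx_eq0 mulmxBl -scalemxAl -rowE yvE !mxE.
  by rewrite divfK // subrr.
rewrite -(subrK ((v i 0 / w 0 0) *: y) (delta_mx 0 i)) e !mulmxDl -!scalemxAl.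
by rewrite !yV ?vV // edet.
Qed.

(** Since g fixes the line of v pointwise, it does not change the restriction of p to that line. *)
Lemma act_mod_linform v g p : v != 0 -> g \in stab v ->
  divides (linform (perp v)) (act g p - p).
Proof.
move=> v0 /stabP[gW gv]; rewrite -{2}[p]comp_mpoly_id; apply: divides_comp => i.
have := act_linform (rW g) (delta_mx 0 i).
rewrite /act_poly !tnth_mktuple linform_delta comp_mpolyXU -tnth_nth tnth_mktuple.
move=> ->; rewrite -linform_delta -raddfB; apply: divides_linform => //.
rewrite mulmxBl -mulmxA; have /eqP := gv; rewrite -invmx_fix // => /eqP ->.
by rewrite subrr.
Qed.

Lemma act_perp v g : g \in stab v ->
  act g (linform (perp v)) = (\det (rW g))^-1 *: linform (perp v).
Proof.
case/stabP => gW gv.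
by rewrite act_linform perp_invmx ?repr_unitmx // gv linearZ.
Qed.

Lemma det_neq0 g : g \in W -> \det (rW g) != 0.
Proof. by move=> gW; rewrite -unitfE -unitmxE repr_unitmx. Qed.

Definition semi_invariant (p : S) :=
  forall g, g \in W -> act g p = \det (rW g) *: p.

(** Induction on the exponent k: if p = lam^k q with k + 1 < r, where r is the order of the
    stabilizer, some g there satisfies g q = det(g)^(k+1) q with a factor other than 1. As g q is
    congruent to q modulo lam, lam divides q. *)
Lemma semi_invariant_divides v p : mx_faithful rW -> v != 0 -> semi_invariant p ->
  divides (linform (perp v) ^+ #|stab v|.-1) p.
Proof.
move=> fW v0 pW; have : (#|stab v|.-1 <= #|stab v|.-1)%N by [].
elim: {1 3}#|stab v|.-1 => [|k IHk] k_lt; first by exists p; rewrite expr0 mul1r.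
have [q pq] := IHk (ltnW k_lt).
(* The r determinants are distinct, and fewer than r of them can be (k+1)-st roots of unity. *)
have [g gv dg] : exists2 g, g \in stab v & \det (rW g) ^+ k.+1 != 1.
  apply/exists_inP; apply: contraTT k_lt; rewrite negb_exists_in => /forall_inP roots.
  rewrite -ltnNge -ltnS prednK; last first.
    by apply/card_gt0P; exists 1%g; apply: stab1.
  rewrite ltnS cardE -(size_map (fun g => \det (rW g))).
  apply: max_unity_roots => //.
    apply/allP => x /mapP[g]; rewrite mem_enum => gv ->.
    by apply/unity_rootP/eqP; have := roots g gv; rewrite negbK.
  rewrite map_inj_in_uniq ?enum_uniq // => g h; rewrite !mem_enum.
  exact: det_stab_inj.
have gW : g \in W by case/stabP: gv.
have lp0 : linform (perp v) != 0 by rewrite linform_eq0 perp_eq0.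
have act_q : act g q = \det (rW g) ^+ k.+1 *: q.
  apply: (mulfI (expf_neq0 k lp0)); have := pW g gW.
  rewrite pq rmorphM rmorphXn /= act_perp // exprZn -scalerAl => e.
  rewrite -scalerAr exprSr -scalerA -e scalerA exprVn divff ?scale1r //.
  by rewrite expf_neq0 // det_neq0.
have [q' qq'] := act_mod_linform q v0 gv.
exists ((\det (rW g) ^+ k.+1 - 1)^-1 *: q').
rewrite pq exprSr -mulrA -scalerAr -qq' act_q -{3}[q]scale1r -scalerBl scalerA.
by rewrite mulVf ?scale1r // subr_eq0.
Qed.

(** The relations of [d_linform_orbit] for y and for its perturbation alpha are wedged together.
    Among all their linear factors, only those alpha - g alpha with g in the stabilizer vanish at
    v. *)
Lemma jacobian_local v : mx_faithful rW -> v != 0 -> exists L : seq 'rV[C]_2,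
  (forall r, r \in L -> r *m v != 0) /\
  divides jacobian (linform (perp v) ^+ #|stab v|.-1 * linprod L).
Proof.
move=> fW v0; have [y [yv yfix ysep]] := separating_row rW v0.
have yV g : g \in stab v -> y *m invmx (rW g) = y.
  by case/stabP=> gW gv; rewrite -{1}(yfix g gW gv) mulmxK ?repr_unitmx.
have yVsep g : g \in W -> y *m invmx (rW g) *m v = y *m v -> g \in stab v.
  move=> gW e; apply/stabP; split=> //; apply/eqP; rewrite -invmx_fix //.
  by rewrite -repr_mxV // ysep ?groupV // repr_mxV.
(* The only eps for which alpha - g alpha could vanish at v. If the denominator is 0 the quotient is
   0 by convention; that case is treated apart, since then eps has no influence. *)
pose bad g : C := (y *m v - y *m invmx (rW g) *m v) 0 0
                   / (perp v *m invmx (rW g) *m v) 0 0.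
have [eps] := exists_notin (0 :: [seq bad g | g <- enum W]).
rewrite inE negb_or => /andP[eps0 epsP].
pose alpha := y + eps *: perp v.
have alphaE : alpha *m v = y *m v.
  by rewrite mulmxDl -scalemxAl perp_mul scaler0 addr0.
have alpha_sep g : g \in W -> g \notin stab v ->
    (alpha - alpha *m invmx (rW g)) *m v != 0.
  move=> gW; apply: contraNN => /eqP.
  rewrite mulmxBl alphaE /alpha !mulmxDl -!scalemxAl opprD addrA => /eqP.
  rewrite subr_eq0 => /eqP e.
  have [pg0|pg0] := eqVneq (perp v *m invmx (rW g) *m v) 0.
    by apply: yVsep => //; apply/eqP; rewrite eq_sym -subr_eq0 e pg0 scaler0.
  case/negP: epsP; apply/mapP; exists g; rewrite ?mem_enum //.
  by rewrite /bad e mxE mulfK // -mulmx_eq0.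
(* The list of images of y contains y once for each element of the stabilizer; duplicates are
   removed to make y a simple root. *)
pose Oy := undup [seq y *m invmx (rW g) | g <- enum W].
have yOy : y \in Oy.
  rewrite mem_undup; apply/mapP; exists 1%g; rewrite ?mem_enum //.
  by rewrite repr_mx1 invmx1 mulmx1.
have stable_perm (f : 'rV[C]_2 -> 'rV[C]_2) O O' : perm_eq O' O ->
    perm_eq [seq f r | r <- O] O -> perm_eq [seq f r | r <- O'] O'.
  move=> OO' Of; apply: perm_trans (perm_map f OO') _.
  by apply: perm_trans Of _; rewrite perm_sym.
have dy : in_span_df (fun i => linprod [seq y - s | s <- rem y Oy] * (y 0 i)%:MP).
  apply: d_linform_orbit => g gW.
  apply: (stable_perm _ Oy); first by rewrite perm_sym perm_to_rem.
  rewrite -undup_map_inj; first exact/perm_undup/perm_mem/orbit_stable.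
  by apply: (can_inj (mulmxK _)); rewrite unitmx_inv repr_unitmx.
have perm_W : perm_eq (1%g :: enum (W :\ 1%g)) (enum W).
  apply: uniq_perm; rewrite /= ?enum_uniq ?andbT ?mem_enum ?setD11 //.
  move=> g; rewrite inE !mem_enum !inE; case: eqP => // ->.
  by rewrite group1.
have dalpha : in_span_df (fun i => linprod [seq alpha - s | s <-
    [seq alpha *m invmx (rW g) | g <- enum (W :\ 1%g)]] * (alpha 0 i)%:MP).
  apply: d_linform_orbit => g gW; apply: stable_perm (orbit_stable alpha gW).
  have := perm_map (fun g => alpha *m invmx (rW g)) perm_W.
  by rewrite /= repr_mx1 invmx1 mulmx1.
have := jacobian_divides dy dalpha; rewrite /= -map_comp.
pose Ly := [seq y - s | s <- rem y Oy].
pose La := [seq alpha - alpha *m invmx (rW g) | g <- enum ((W :\ 1%g) :\: stab v)].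
pose c g := eps * (1 - (\det (rW g))^-1).
(* For g in the stabilizer, y is fixed, so alpha - g alpha = eps (1 - det(g)^-1) lam; the r - 1
   nontrivial such g give the power of lam. *)
have -> : linprod [seq (fun s => alpha - s) ((fun g => alpha *m invmx (rW g)) g)
    | g <- enum (W :\ 1%g)]
    = (\prod_(g in (W :\ 1%g) :&: stab v) c g)%:MP
      * linform (perp v) ^+ #|stab v|.-1 * linprod La.
  rewrite /linprod !big_map !big_enum /= (big_setID (stab v)) /=; congr (_ * _).
  rewrite (eq_bigr (fun g => (c g)%:MP * linform (perp v))) => [|g].
    rewrite big_split prodr_const rmorph_prod /= setIDAC (setIidPr (stabW v)).
    by rewrite [in RHS](cardsD1 1%g) stab1.
  rewrite !inE => /andP[_ /andP[gW gv]]; have gv' : g \in stab v by rewrite inE gW.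
  rewrite /alpha mulmxDl yV // opprD addrACA subrr add0r.
  rewrite -scalemxAl -scalerBr perp_invmx ?repr_unitmx // (eqP gv).
  by rewrite -{1}[perp v]scale1r -scalerBl scalerA linearZ /= mul_mpolyC.
have c_neq0 : \prod_(g in (W :\ 1%g) :&: stab v) c g != 0.
  apply/prodf_neq0 => g; rewrite !inE => /andP[/andP[g1 gW] gv].
  have gv' : g \in stab v by rewrite inE.
  rewrite mulf_neq0 // subr_eq0; apply: contraNneq g1 => dg.
  apply/eqP/(det_stab_inj fW v0) => //=; first exact: stab1.
  by rewrite repr_mx1 det1 -[LHS]invrK -dg invr1.
rewrite -/Ly => dJ.
(* Here eps * y(v) is the coefficient of dy /\ dalpha, so the wedge is a nonzero constant times the
   desired product. *)
have kappa0 : \prod_(g in (W :\ 1%g) :&: stab v) c g * (eps * (y *m v) 0 0) != 0.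
  by rewrite !mulf_neq0 // -mulmx_eq0.
exists (Ly ++ La); split=> [r|]; last first.
  move: kappa0 dJ; rewrite mul_row_col2 /linprod big_cat /= -/(linprod Ly) -/(linprod La).
  move: (\prod_(g in _) c g) => K kappa0 dJ.
  set X := linform _ ^+ _; suff -> : X * (linprod Ly * linprod La)
      = ((K * (eps * (y 0 0 * v 0 0 + y 0 1 * v 1 0)))^-1)%:MP *
        (linprod Ly * (y 0 0)%:MP * (K%:MP * X * linprod La * (alpha 0 1)%:MP) -
         linprod Ly * (y 0 1)%:MP * (K%:MP * X * linprod La * (alpha 0 0)%:MP)).
    exact: dividesMl.
  have -> : linprod Ly * (y 0 0)%:MP * (K%:MP * X * linprod La * (alpha 0 1)%:MP) -
         linprod Ly * (y 0 1)%:MP * (K%:MP * X * linprod La * (alpha 0 0)%:MP)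
      = (K * (eps * (y 0 0 * v 0 0 + y 0 1 * v 1 0)))%:MP * (X * (linprod Ly * linprod La)).
    rewrite !mxE /= !(rmorphM, rmorphD, rmorphN) /=; ring.
  by rewrite [RHS]mulrA -mpolyCM mulVf // mpolyC1 mul1r.
  rewrite mem_cat => /orP[/mapP[s]|/mapP[g]]; last first.
    rewrite mem_enum !inE => /andP[gNv /andP[_ gW]] ->.
    by apply: alpha_sep; rewrite // inE.
  rewrite mem_rem_uniq ?undup_uniq // inE mem_undup => /andP[sy /mapP[g]].
  rewrite mem_enum => gW e ->; apply: contraNneq sy; rewrite mulmxBl => /eqP.
  by rewrite subr_eq0 e => /eqP/esym/yVsep/yV ->.
Qed.

End Solomon.

(** * Invariant 1-forms *)

Lemma wedge_linear (T : comNzRingType) (a b c d m00 m01 m10 m11 : T) :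
  (m00 * m11 - m01 * m10) * (a * d - b * c)
  = (a * m00 + b * m10) * (c * m01 + d * m11)
    - (a * m01 + b * m11) * (c * m00 + d * m10).
Proof. ring. Qed.

Section InvariantOneForms.
Context {C : numClosedFieldType} {gT : finGroupType} {W : {group gT}}.
Variables (rW : mx_representation C W 2) (f1 f2 : {mpoly C[2]}).
Hypothesis invariant_comp : forall p, inv_poly rW p ->
  exists q : {mpoly C[2]}, p = q \mPo [tuple f1; f2].
Hypothesis fW : mx_faithful rW.
Implicit Types (v : 'cV[C]_2) (g : gT) (p q : {mpoly C[2]}).
Implicit Types h k : 'I_2 -> {mpoly C[2]}.

Local Notation act g := (act_poly (rW g)).
Local Notation semi_invariant := (semi_invariant rW).
Local Notation jacobian := (jacobian f1 f2).

(** By [jacobian_local] at any one vector, J divides a product of nonzero linear forms. *)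
Lemma jacobian_neq0 : jacobian != 0.
Proof.
have v0 : (const_mx 1 : 'cV[C]_2) != 0.
  by apply/eqP => /colP/(_ 0); rewrite !mxE; apply/eqP; rewrite oner_eq0.
have [L [Lv [q]]] := jacobian_local invariant_comp fW v0; apply: contra_eq_neq => ->.
rewrite mul0r mulf_neq0 ?expf_neq0 ?linform_eq0 ?perp_eq0 //.
rewrite /linprod prodf_seq_neq0; apply/allP => r /Lv /=; rewrite linform_eq0.
by apply: contraNneq => ->; rewrite mul0mx.
Qed.

Lemma jacobian_divides_semi_invariant p : semi_invariant p ->
  divides jacobian p.
Proof.
move=> pW; apply: divides_local jacobian_neq0 _ => v v0.
have [L [Lv dL]] := jacobian_local invariant_comp fW v0; exists L; split=> //.
have [q ->] := semi_invariant_divides fW v0 pW.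
by rewrite mulrAC; apply: dividesMr.
Qed.

Definition invariant_1form (h : 'I_2 -> {mpoly C[2]}) := forall g l, g \in W ->
  h l = \sum_i act g (h i) * (invmx (rW g) i l)%:MP.

Lemma invariant_1form_d p : inv_poly rW p -> invariant_1form (fun i => p^`M(i)).
Proof.
by move=> pW g l gW; rewrite -mderiv_act pW.
Qed.

(** The coefficient of h /\ k transforms by the determinant of the matrix acting on 1-forms, that
    is, by det(g)^-1; inverting gives the factor det(g). *)
Lemma semi_invariant_wedge h k : invariant_1form h -> invariant_1form k ->
  semi_invariant (h 0 * k 1 - h 1 * k 0).
Proof.
move=> hW kW g gW; apply: (@scalerI _ _ (\det (rW g))^-1).
  exact: invr_neq0 (det_neq0 rW gW).
have -> : act g (h 0 * k 1 - h 1 * k 0)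
    = act g (h 0) * act g (k 1) - act g (h 1) * act g (k 0).
  by rewrite rmorphB !rmorphM.
rewrite scalerA mulVf ?(det_neq0 rW gW) // scale1r -det_inv det2 -mul_mpolyC.
rewrite mpolyCB !mpolyCM.
rewrite wedge_linear; congr (_ * _ - _ * _).
- by rewrite [RHS](hW g 0 gW) sum_ord2.
- by rewrite [RHS](kW g 1 gW) sum_ord2.
- by rewrite [RHS](hW g 1 gW) sum_ord2.
by rewrite [RHS](kW g 0 gW) sum_ord2.
Qed.

Hypotheses (f1_inv : inv_poly rW f1) (f2_inv : inv_poly rW f2).

Lemma jacobian_quotient p : semi_invariant p ->
  exists c, inv_poly rW c /\ p = jacobian * c.
Proof.
move=> pW; have [c pc] := jacobian_divides_semi_invariant pW.
exists c; split=> // g gW; have jW : semi_invariant jacobian.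
  exact: semi_invariant_wedge (invariant_1form_d f1_inv) (invariant_1form_d f2_inv).
have := pW g gW; rewrite pc rmorphM /= jW // -scalerAl.
move/(scalerI (det_neq0 rW gW)); apply: mulfI; exact: jacobian_neq0.
Qed.

Theorem invariant_1form_span h : invariant_1form h ->
  exists c1 c2, [/\ inv_poly rW c1, inv_poly rW c2
    & forall i, h i = c1 * f1^`M(i) + c2 * f2^`M(i)].
Proof.
move=> hW.
have [c1 [c1W e1]] := jacobian_quotient
  (semi_invariant_wedge hW (invariant_1form_d f2_inv)).
have [c2 [c2W e2]] := jacobian_quotient
  (semi_invariant_wedge (invariant_1form_d f1_inv) hW).
exists c1, c2; split=> // i; apply: (mulfI jacobian_neq0).
rewrite mulrDr !mulrA -e1 -e2 /jacobian.
by case: (ord2P i) => ->; ring.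
Qed.

Lemma d_free c1 c2 : (forall i, c1 * f1^`M(i) + c2 * f2^`M(i) = 0) ->
  c1 = 0 /\ c2 = 0.
Proof.
move=> c0; split; apply: (mulfI jacobian_neq0); rewrite mulr0.
  transitivity ((c1 * f1^`M(0) + c2 * f2^`M(0)) * f2^`M(1)
    - (c1 * f1^`M(1) + c2 * f2^`M(1)) * f2^`M(0)); last by rewrite !c0; ring.
  by rewrite /jacobian; ring.
transitivity ((c1 * f1^`M(1) + c2 * f2^`M(1)) * f1^`M(0)
  - (c1 * f1^`M(0) + c2 * f2^`M(0)) * f1^`M(1)); last by rewrite !c0; ring.
by rewrite /jacobian; ring.
Qed.

End InvariantOneForms.

(** * Coordinates of forms in the plane *)

Section PlaneForms.
Context {F : fieldType}.
Local Notation S := {mpoly F[2]}.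
Implicit Types (al be : Defs.form F 2) (om : formder F 2) (A : 'M[F]_2) (i j k : 'I_2).

Lemma set_ord2P (I : {set 'I_2}) :
  [\/ I = set0, I = [set 0], I = [set 1] | I = setT].
Proof.
case I0: (0 \in I); case I1: (1 \in I);
  [constructor 4 | constructor 2 | constructor 3 | constructor 1];
  by apply/setP => i; rewrite !inE; case: (ord2P i) => ->.
Qed.

Lemma set1T i : ([set i] == setT :> {set 'I_2}) = false.
Proof.
by apply/negP => /eqP/(congr1 (fun I => #|pred_of_set I|));
  rewrite cards1 cardsT card_ord.
Qed.

Lemma setT0 : (setT == set0 :> {set 'I_2}) = false.
Proof. by apply/negP => /eqP/setP/(_ 0); rewrite !inE. Qed.

Lemma set1_0 i : ([set i] == set0 :> {set 'I_2}) = false.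
Proof. by apply/negP => /eqP/setP/(_ i); rewrite !inE eqxx. Qed.

Lemma sum_set_ord2 (V : nmodType) (f : {set 'I_2} -> V) :
  \sum_(I : {set 'I_2}) f I = f set0 + f [set 0] + f [set 1] + f setT.
Proof.
rewrite (bigD1 set0) // (bigD1 [set 0]) ?set1_0 // (bigD1 [set 1]) /=; last first.
  by rewrite set1_0 (inj_eq set1_inj).
rewrite (bigD1 setT) /= ?setT0 ?[setT == _]eq_sym ?set1T // big1 ?addr0 ?addrA //.
by move=> I; case: (set_ord2P I) => ->; rewrite !eqxx ?andbF.
Qed.

Lemma inversions_ord2 (I J : {set 'I_2}) :
  inversions I J = ((1 \in I) && (0 \in J) : nat).
Proof.
rewrite /inversions; have -> : [set u : 'I_2 * 'I_2 |
    [&& u.1 \in I, u.2 \in J & (u.2 < u.1)%N]]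
    = if (1 \in I) && (0 \in J) then [set (1, 0)] else set0.
  apply/setP => -[i j]; rewrite !inE /=.
  case: (ord2P i) => ->; case: (ord2P j) => ->; rewrite /= ?andbF ?andbT;
    by case: ifP; rewrite inE.
by case: ifP; rewrite ?cards1 ?cards0.
Qed.

Lemma form_ext al be : al set0 = be set0 -> (forall i, al [set i] = be [set i]) ->
  al setT = be setT -> al = be.
Proof.
by move=> e0 e1 e2; apply/ffunP => I; case: (set_ord2P I) => ->.
Qed.

Lemma wedge0 al be : wedge al be set0 = (al set0 : S) * (be set0 : S).
Proof.
rewrite ffunE big_mkcond sum_set_ord2 !subset0 eqxx !set1_0 setT0 !addr0.
by rewrite inversions_ord2 inE setD0 mul1r.
Qed.

Lemma wedge1 al be i : wedge al be [set i]
  = (al set0 : S) * (be [set i] : S) + (al [set i] : S) * (be set0 : S).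
Proof.
rewrite ffunE big_mkcond sum_set_ord2 sub0set !sub1set subTset [[set i] == _]set1T.
rewrite !inE !inversions_ord2 !inE /= addr0 setD0 mul1r.
by case: (ord2P i) => ->; rewrite ?eqxx setDv !mul1r ?addr0.
Qed.

Lemma wedgeT al be : wedge al be setT
  = (al set0 : S) * (be setT : S) + (al [set 0] : S) * (be [set 1] : S)
    - (al [set 1] : S) * (be [set 0] : S) + (al setT : S) * (be set0 : S).
Proof.
rewrite ffunE big_mkcond sum_set_ord2 !subsetT !inversions_ord2 setD0 setDv.
have -> : setT :\: [set 0] = [set 1] :> {set 'I_2}.
  by apply/setP => i; rewrite !inE; case: (ord2P i) => ->.
have -> : setT :\: [set 1] = [set 0] :> {set 'I_2}.
  by apply/setP => i; rewrite !inE; case: (ord2P i) => ->.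
by rewrite !inE /= expr0 expr1 !mul1r mulN1r.
Qed.

Lemma enum_setT2 : enum (setT : {set 'I_2}) = [:: 0; 1].
Proof.
apply: (inj_map val_inj).
by rewrite enum_setT -enumT val_enum_ord.
Qed.

Lemma poly_form0 (p : S) : poly_form p set0 = p :> S.
Proof. by rewrite ffunE eqxx. Qed.

Lemma poly_form1 (p : S) i : poly_form p [set i] = 0 :> S.
Proof. by rewrite ffunE set1_0. Qed.

Lemma poly_formT (p : S) : poly_form p setT = 0 :> S.
Proof. by rewrite ffunE setT0. Qed.

Lemma act_xform_set0 A i : act_xform A i set0 = 0.
Proof.
rewrite /act_xform sum_ffunE big1 // => j _.
by rewrite !ffunE eq_sym set1_0 scaler0.
Qed.
Lemma act_xform_setT A i : act_xform A i setT = 0.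
Proof.
rewrite /act_xform sum_ffunE big1 // => j _.
by rewrite !ffunE eq_sym set1T scaler0.
Qed.
Lemma act_xform_set1 A i j : act_xform A i [set j] = (invmx A i j)%:MP.
Proof.
rewrite /act_xform sum_ffunE (bigD1 j) //= big1 => [|l lj].
  by rewrite !ffunE eqxx addr0 -[RHS]mulr1.
by rewrite !ffunE (inj_eq set1_inj) eq_sym (negbTE lj) scaler0.
Qed.

Lemma formZE (c : S) al K : (c *: al) K = c * (al K : S) :> S.
Proof. by rewrite ffunE. Qed.

Section ActForm.
Variables (A : 'M[F]_2) (al : Defs.form F 2).

(* Rewriting inside a value of a finite function of this depth makes         *)
(* unification unfold wedge, hence the values as arguments.                  *)
Lemma act_form_eval (K : {set 'I_2}) (c0 c1 c2 c3 : S) :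
  poly_form 1 K = c0 -> wedge (act_xform A 0) (poly_form 1) K = c1 ->
  wedge (act_xform A 1) (poly_form 1) K = c2 ->
  wedge (act_xform A 0) (wedge (act_xform A 1) (poly_form 1)) K = c3 ->
  act_form A al K = (act_poly A (al set0) : S) * c0
    + (act_poly A (al [set 0]) : S) * c1 + (act_poly A (al [set 1]) : S) * c2
    + (act_poly A (al setT) : S) * c3.
Proof.
move=> <- <- <- <-; rewrite /act_form sum_ffunE.
transitivity (\sum_(I : {set 'I_2}) (act_poly A (al I) : S)
    * ((\big[@wedge F 2/poly_form 1]_(i <- enum I) act_xform A i) K : S)).
  by apply: eq_bigr => I _; apply: formZE.
rewrite sum_set_ord2 enum_set0 !enum_set1 enum_setT2.
by rewrite big_nil !big_cons big_nil.
Qed.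

Lemma wedge_act0 i : wedge (act_xform A i) (poly_form 1) set0 = 0.
Proof. by apply: etrans (wedge0 _ _) _; rewrite act_xform_set0 mul0r. Qed.

Lemma wedge_act1 i l :
  wedge (act_xform A i) (poly_form 1) [set l] = (invmx A i l)%:MP.
Proof.
apply: etrans (wedge1 _ _ _) _.
by rewrite act_xform_set0 act_xform_set1 poly_form0 mul0r add0r mulr1.
Qed.

Lemma wedge_actT i : wedge (act_xform A i) (poly_form 1) setT = 0.
Proof.
apply: etrans (wedgeT _ _) _; rewrite act_xform_set0 act_xform_setT.
by rewrite !poly_form1 !(mul0r, mulr0, addr0, oppr0).
Qed.

Lemma act_form0 : act_form A al set0 = act_poly A (al set0).
Proof.
apply: etrans (act_form_eval (poly_form0 1) (wedge_act0 0) (wedge_act0 1) _) _.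
  by apply: etrans (wedge0 _ _) _; rewrite act_xform_set0 mul0r.
by rewrite !mulr0 !addr0 mulr1.
Qed.

Lemma act_form1 l : act_form A al [set l]
  = \sum_i (act_poly A (al [set i]) : S) * (invmx A i l)%:MP :> S.
Proof.
apply: etrans (act_form_eval (poly_form1 1 l) (wedge_act1 0 l) (wedge_act1 1 l) _) _.
  apply: etrans (wedge1 _ _ _) _; rewrite act_xform_set0 mul0r add0r.
  by rewrite wedge_act0 mulr0.
by rewrite !mulr0 addr0 add0r sum_ord2.
Qed.

Lemma act_formT : act_form A al setT
  = (act_poly A (al setT) : S) * (\det (invmx A))%:MP :> S.
Proof.
apply: etrans (act_form_eval (poly_formT 1) (wedge_actT 0) (wedge_actT 1) _) _.
  apply: etrans (wedgeT _ _) _; rewrite act_xform_set0 act_xform_setT.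
  by rewrite !act_xform_set1 !wedge_act1 !mul0r addr0 add0r.
by rewrite !mulr0 !add0r det2 mpolyCB !mpolyCM.
Qed.

End ActForm.

Lemma act_formder0 A om k : act_formder A om k set0
  = \sum_j (A k j)%:MP * (act_poly A (om j set0) : S) :> S.
Proof.
rewrite ffunE sum_ffunE; apply: eq_bigr => j _.
by rewrite -act_form0; apply: formZE.
Qed.

Lemma act_formder1 A om k l : act_formder A om k [set l]
  = \sum_j (A k j)%:MP *
      \sum_i (act_poly A (om j [set i]) : S) * (invmx A i l)%:MP :> S.
Proof.
rewrite ffunE sum_ffunE; apply: eq_bigr => j _.
by rewrite -act_form1; apply: formZE.
Qed.

Lemma act_formderT A om k : act_formder A om k setT
  = \sum_j (A k j)%:MP *
      ((act_poly A (om j setT) : S) * (\det (invmx A))%:MP) :> S.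
Proof.
rewrite ffunE sum_ffunE; apply: eq_bigr => j _.
by rewrite -act_formT; apply: formZE.
Qed.

End PlaneForms.

(** * Euler's identity and homogeneous polynomials *)

Section Euler.
Context {F : fieldType} {n : nat}.

Lemma euler_dhomog (p : {mpoly F[n]}) d : p \is d.-homog ->
  \sum_i p^`M(i) * 'X_i = d%:R *: p.
Proof.
move/dhomogP => p_homog; rewrite [in RHS](mpolyE p) scaler_sumr.
under eq_bigr do rewrite {1}(mpolyE p) raddf_sum /= mulr_suml.
rewrite exchange_big /=; apply: eq_big_seq => m /p_homog <-.
under eq_bigr => i _.
  rewrite mderivZ mderivX -!scalerAl -mpolyXD.
  have -> : (m i)%:R *: 'X_[m - U_(i) + U_(i)] = (m i)%:R *: 'X_[m] :> {mpoly F[n]}.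
    case: (eqVneq (m i) 0%N) => [->|mi]; first by rewrite !scale0r.
    by rewrite submK // lep1mP.
  over.
rewrite -scaler_sumr -scaler_suml scalerA mulrC -scalerA; congr (_ *: (_ *: _)).
by rewrite /= mdegE natr_sum.
Qed.

Lemma dhomog0_const (p : {mpoly F[n]}) : p \is 0.-homog -> p = (p@_0)%:MP.
Proof.
move/dhomogP => p_homog; apply/mpolyP => m; rewrite mcoeffC.
case: eqP => [->|m0]; first by rewrite mulr1.
rewrite mulr0; apply/memN_msupp_eq0/negP => /p_homog /eqP.
by rewrite mdeg_eq0 => /eqP.
Qed.

End Euler.

(** * Equivariant vector and matrix fields *)

Section EquivariantFields.
Context {C : numClosedFieldType} {gT : finGroupType} {W : {group gT}}.
Variable rW : mx_representation C W 2.
Local Notation S := {mpoly C[2]}.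
Local Notation act g := (act_poly (rW g)).
Implicit Types (g : gT) (p q tau u : 'I_2 -> S) (Om : 'I_2 -> 'I_2 -> S).

Definition equivariant_vec p := forall g k, g \in W ->
  p k = \sum_j (rW g k j)%:MP * act g (p j).

(** Invariance of the coefficients of x_0 /\ x_1, on which g acts by det(g^-1). *)
Definition twisted_vec tau := forall g k, g \in W ->
  tau k = \sum_j (rW g k j)%:MP * (act g (tau j) * (\det (invmx (rW g)))%:MP).

Definition equivariant_mx Om := forall g k l, g \in W ->
  Om k l = \sum_j (rW g k j)%:MP *
             \sum_i act g (Om j i) * (invmx (rW g) i l)%:MP.

Lemma eq_equivariant_vec p q : p =1 q -> equivariant_vec p -> equivariant_vec q.
Proof.
move=> pq pW g k gW; rewrite -pq (pW g k gW).
by apply: eq_bigr => j _; rewrite pq.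
Qed.

Lemma eq_twisted_vec p q : p =1 q -> twisted_vec p -> twisted_vec q.
Proof.
move=> pq pW g k gW; rewrite -pq (pW g k gW).
by apply: eq_bigr => j _; rewrite pq.
Qed.

Lemma eq_equivariant_mx Om Om' : Om =2 Om' ->
  equivariant_mx Om -> equivariant_mx Om'.
Proof.
move=> OmOm' OmW g k l gW; rewrite -OmOm' (OmW g k l gW).
apply: eq_bigr => j _; congr (_ * _); apply: eq_bigr => i _.
by rewrite OmOm'.
Qed.

Lemma equivariant_mxB Om Om' : equivariant_mx Om -> equivariant_mx Om' ->
  equivariant_mx (fun k l => Om k l - Om' k l).
Proof.
move=> OmW OmW' g k l gW; rewrite (OmW g k l gW) (OmW' g k l gW) -sumrB.
apply: eq_bigr => j _; rewrite -mulrBr -sumrB; congr (_ * _).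
by apply: eq_bigr => i _; rewrite rmorphB mulrBl.
Qed.

Lemma equivariant_mxZ c Om : inv_poly rW c -> equivariant_mx Om ->
  equivariant_mx (fun k l => c * Om k l).
Proof.
move=> cW OmW g k l gW; rewrite (OmW g k l gW) mulr_sumr.
apply: eq_bigr => j _; rewrite mulrCA; congr (_ * _); rewrite mulr_sumr.
by apply: eq_bigr => i _; rewrite rmorphM /= (cW g gW) mulrA.
Qed.

Lemma equivariant_mx_d p : equivariant_vec p ->
  equivariant_mx (fun k l => (p k)^`M(l)).
Proof.
move=> pW g k l gW; rewrite {1}(pW g k gW) raddf_sum; apply: eq_bigr => j _ /=.
by rewrite mderivM mderivC mul0r add0r mderiv_act.
Qed.

Lemma equivariant_mx_tensor p h : equivariant_vec p -> invariant_1form rW h ->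
  equivariant_mx (fun k l => p k * h l).
Proof.
move=> pW hW g k l gW; rewrite {1}(pW g k gW) {1}(hW g l gW) mulr_suml.
apply: eq_bigr => j _; rewrite -mulrA; congr (_ * _); rewrite mulr_sumr.
by apply: eq_bigr => i _; rewrite rmorphM mulrA.
Qed.

(** The Euler vector field is invariant: the substitution on each ['X_i] absorbs the matrix acting
    on the form index. *)
Lemma equivariant_mx_euler Om : equivariant_mx Om ->
  equivariant_vec (fun k => \sum_l Om k l * 'X_l).
Proof.
move=> OmW g k gW; under eq_bigr do rewrite (OmW g k _ gW) mulr_suml.
rewrite exchange_big; apply: eq_bigr => j _ /=.
under eq_bigr do rewrite -mulrA mulr_suml.
rewrite -mulr_sumr exchange_big; congr (_ * _).
rewrite raddf_sum; apply: eq_bigr => i _ /=; rewrite rmorphM /= act_polyX mulr_sumr.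
by apply: eq_bigr => l _; rewrite mulrA.
Qed.

(** In dimension 2, the quarter turn realizes the isomorphism of V tensored with det^-1 onto V^*. *)
Definition rotate tau : 'I_2 -> S := fun l => if l == 0 then tau 1 else - tau 0.

(** Cramer's formula for the inverse, read off from [perp_invmx] at the two basis vectors. *)
Lemma invmxE2 (A : 'M[C]_2) : A \in unitmx ->
  [/\ invmx A 0 0 = A 1 1 * \det (invmx A), invmx A 0 1 = - A 0 1 * \det (invmx A),
      invmx A 1 0 = - A 1 0 * \det (invmx A) & invmx A 1 1 = A 0 0 * \det (invmx A)].
Proof.
move=> uA; rewrite det_inv.
have rowE (v : 'cV[C]_2) l : - v 1 0 * invmx A 0 l + v 0 0 * invmx A 1 l
    = (\det A)^-1 * perp (A *m v) 0 l.
  have /rowP/(_ l) := perp_invmx v uA.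
  by rewrite !mxE sum_ord2 perp0E perp1E.
have := rowE (delta_mx 0 0) 0; have := rowE (delta_mx 0 0) 1.
have := rowE (delta_mx 1 0) 0; have := rowE (delta_mx 1 0) 1.
rewrite -!colE !perp0E !perp1E !mxE /= oppr0 !mul0r !mul1r !add0r !addr0 !mulN1r.
move=> e01 e00 e11 e10; split.
- by rewrite -[LHS]opprK e00; ring.
- by rewrite -[LHS]opprK e01; ring.
- by rewrite e10; ring.
by rewrite e11; ring.
Qed.

Lemma twisted_rotate tau : twisted_vec tau <-> invariant_1form rW (rotate tau).
Proof.
have eqs g : g \in W ->
  \sum_i act g (rotate tau i) * (invmx (rW g) i 0)%:MP
    = \sum_j (rW g 1 j)%:MP * (act g (tau j) * (\det (invmx (rW g)))%:MP) /\
  \sum_i act g (rotate tau i) * (invmx (rW g) i 1)%:MP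
    = - \sum_j (rW g 0 j)%:MP * (act g (tau j) * (\det (invmx (rW g)))%:MP).
  move=> gW; rewrite !sum_ord2 /rotate /=.
  have [-> -> -> ->] := invmxE2 (repr_unitmx rW gW).
  rewrite !mpolyCM !mpolyCN rmorphN /=.
  move: (act_poly _ _) (act_poly _ _) => a b.
  by split; ring.
split=> tauW g k gW; have [e0 e1] := eqs g gW.
  case: (ord2P k) => ->; first by rewrite e0 -tauW.
  by rewrite e1 -tauW.
case: (ord2P k) => ->; last by rewrite -e0 -tauW.
by apply: oppr_inj; rewrite -e1 -tauW.
Qed.

Lemma divides_X0 (p q : S) : p * 'X_1 = - (q * 'X_0) -> exists w, p = 'X_0 * w.
Proof.
move=> pq; pose v : 'cV[C]_2 := \col_i (if i == 0 then 0 else - 1).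
have vX : linform (perp v) = 'X_0.
  rewrite -linform_delta; congr linform.
  by apply: row2P; rewrite !mxE /= ?opprK.
have vX1 : linprod [:: delta_mx 0 1] = 'X_1 :> S.
  by rewrite /linprod big_seq1 linform_delta.
have [|r||w] := @divides_linprod_cancel C v p [:: delta_mx 0 1].
- by apply/eqP => /colP/(_ 1); rewrite !mxE /= => /eqP; rewrite oppr_eq0 oner_eq0.
- rewrite inE => /eqP ->; rewrite -rowE; apply/eqP => /matrixP/(_ 0 0).
  by rewrite !mxE /= => /eqP; rewrite oppr_eq0 oner_eq0.
- by rewrite vX vX1 pq; exists (- q); rewrite mulrN mulrC.
by rewrite vX => ->; exists w.
Qed.

(** Each row of Om is orthogonal to (x_0, x_1), and these are coprime, so the row is a multiple of
    (- x_1, x_0). *)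
Lemma equivariant_mx_kernel Om : equivariant_mx Om ->
  (forall k, \sum_l Om k l * 'X_l = 0) ->
  exists u, twisted_vec u /\ forall k, Om k 0 = - (u k * 'X_1) /\ Om k 1 = u k * 'X_0.
Proof.
move=> OmW Om0.
have divX k : exists w, Om k 1 = 'X_0 * w.
  apply: (@divides_X0 _ (Om k 0)); apply/eqP; rewrite -addr_eq0 addrC.
  by have := Om0 k; rewrite sum_ord2 => ->.
have [w0 w0E] := divX 0; have [w1 w1E] := divX 1.
pose u (k : 'I_2) : S := if k == 0 then w0 else w1.
have Om1E k : Om k 1 = u k * 'X_0.
  by case: (ord2P k) => ->; rewrite ?w0E ?w1E mulrC.
have X0 : 'X_0 != 0 :> S.
  rewrite -linform_delta linform_eq0; apply/eqP => /rowP/(_ 0); rewrite !mxE /=.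
  by apply/eqP; rewrite oner_eq0.
have Om0E k : Om k 0 = - (u k * 'X_1).
  apply: (mulIf X0); apply/eqP; rewrite mulNr -addr_eq0 mulrAC.
  by have := Om0 k; rewrite sum_ord2 Om1E => ->.
exists u; split=> // g k gW; apply: (mulIf X0).
(* Equivariance is compared in column 1 only; the substituted variables combine there into det(g^-1)
   x_0, and x_0 cancels. *)
rewrite -Om1E (OmW g k 1 gW) mulr_suml; apply: eq_bigr => j _.
rewrite -mulrA; congr (_ * _); rewrite sum_ord2 Om0E Om1E rmorphN !rmorphM /=.
rewrite !act_polyX !sum_ord2 det2 mpolyCB !mpolyCM.
by move: (act_poly _ _) => c; ring.
Qed.

End EquivariantFields.

(** * Spanning and freeness in coordinates *)

Section Coordinates.
Context {C : numClosedFieldType} {gT : finGroupType} {W : {group gT}}.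
Variables (rW : mx_representation C W 2) (f1 f2 : {mpoly C[2]}).
Local Notation S := {mpoly C[2]}.
Local Notation act g := (act_poly (rW g)).

Lemma inv_polyM (p q : S) : inv_poly rW p -> inv_poly rW q -> inv_poly rW (p * q).
Proof. by move=> pW qW g gW; rewrite rmorphM /= pW // qW. Qed.

Lemma inv_polyD (p q : S) : inv_poly rW p -> inv_poly rW q -> inv_poly rW (p + q).
Proof. by move=> pW qW g gW; rewrite rmorphD /= pW // qW. Qed.

Lemma inv_polyN (p : S) : inv_poly rW p -> inv_poly rW (- p).
Proof. by move=> pW g gW; rewrite rmorphN /= pW. Qed.

Lemma inv_polyZ c (p : S) : inv_poly rW p -> inv_poly rW (c *: p).
Proof. by move=> pW g gW; rewrite act_polyZ pW. Qed.

Hypothesis invariant_comp : forall p, inv_poly rW p ->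
  exists q : {mpoly C[2]}, p = q \mPo [tuple f1; f2].
Hypothesis fW : mx_faithful rW.
Hypotheses (f1_inv : inv_poly rW f1) (f2_inv : inv_poly rW f2).

Lemma twisted_vec_span tau : twisted_vec rW tau -> exists c1 c2,
  [/\ inv_poly rW c1, inv_poly rW c2
    & forall k, tau k = c1 * (if k == 0 then - f1^`M(1) else f1^`M(0))
                      + c2 * (if k == 0 then - f2^`M(1) else f2^`M(0))].
Proof.
move/twisted_rotate/(invariant_1form_span invariant_comp fW f1_inv f2_inv).
move=> [c1 [c2 [c1W c2W tauE]]]; exists c1, c2; split=> // k.
case: (ord2P k) => -> /=; last by rewrite -tauE.
by rewrite !mulrN -opprD -tauE opprK.
Qed.

Variables (d1 d2 e : nat) (t : 'I_2 -> S).
Hypotheses (f1_homog : f1 \is d1.-homog) (f2_homog : f2 \is d2.-homog).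
Hypotheses (t_homog : forall k, t k \is e.-homog) (e_gt0 : (0 < e)%N).
Hypotheses (xW : equivariant_vec rW (fun k => 'X_k)) (tW : equivariant_vec rW t).
Hypothesis span0 : forall p, equivariant_vec rW p -> exists c1 c2,
  [/\ inv_poly rW c1, inv_poly rW c2 & forall k, p k = c1 * 'X_k + c2 * t k].
Hypothesis free0 : forall c1 c2, inv_poly rW c1 -> inv_poly rW c2 ->
  (forall k, c1 * 'X_k + c2 * t k = 0) -> c1 = 0 /\ c2 = 0.

Lemma inv_euler f d : inv_poly rW f -> f \is d.-homog ->
  inv_poly rW (\sum_i f^`M(i) * 'X_i).
Proof. by move=> fW' /euler_dhomog ->; apply: inv_polyZ. Qed.

Lemma e_neq0 : e%:R != 0 :> C.
Proof. by rewrite pnatr_eq0 -lt0n. Qed.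

Lemma equivariant_mx_span Om : equivariant_mx rW Om -> exists c1 c2 c3 c4,
  [/\ inv_poly rW c1, inv_poly rW c2, inv_poly rW c3 & inv_poly rW c4] /\
  forall k l, Om k l = c1 * ('X_k * f1^`M(l)) + c2 * ('X_k * f2^`M(l))
    + c3 * ('X_k)^`M(l) + c4 * (t k)^`M(l).
Proof.
move=> OmW; have [a1 [a2 [a1W a2W aE]]] := span0 (equivariant_mx_euler OmW).
have a2W' : inv_poly rW (e%:R^-1 *: a2) by apply: inv_polyZ.
have Om'W := equivariant_mxB (equivariant_mxB OmW
  (equivariant_mxZ a1W (equivariant_mx_d xW))) (equivariant_mxZ a2W' (equivariant_mx_d tW)).
have [|u [uW uE]] := equivariant_mx_kernel Om'W.
  move=> k; under eq_bigr do rewrite !mulrBl -!mulrA.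
  rewrite !sumrB -!mulr_sumr aE (euler_dhomog (t_homog k)).
  have -> : \sum_l ('X_k : S)^`M(l) * 'X_l = 'X_k.
    rewrite (bigD1 k) //= mderivXU eqxx mul1r big1 ?addr0 // => l lk.
    by rewrite mderivXU eq_sym (negbTE lk) mul0r.
  rewrite -scalerAl -scalerAr scalerA mulVf ?e_neq0 // scale1r.
  by rewrite addrAC addrK subrr.
have [b1 [b2 [b1W b2W bE]]] := twisted_vec_span uW.
pose eps1 := \sum_i f1^`M(i) * 'X_i; pose eps2 := \sum_i f2^`M(i) * 'X_i.
have eps1W : inv_poly rW eps1 := inv_euler f1_inv f1_homog.
have eps2W : inv_poly rW eps2 := inv_euler f2_inv f2_homog.
(* For each f, the matrix with rows h_k (- x_1, x_0), where h = (- df/dx_1, df/dx_0), equals (sum_i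
   x_i df/dx_i) dtheta1 - df theta1. This moves [b1] and [b2] to the first two coefficients and adds
   Euler terms to the third. *)
exists (- b1), (- b2), (a1 + (b1 * eps1 + b2 * eps2)), (e%:R^-1 *: a2).
split.
  split=> //; try exact: inv_polyN.
  by apply: inv_polyD => //; apply: inv_polyD; apply: inv_polyM.
have eps1E : eps1 = f1^`M(0) * 'X_0 + f1^`M(1) * 'X_1 := sum_ord2 _.
have eps2E : eps2 = f2^`M(0) * 'X_0 + f2^`M(1) * 'X_1 := sum_ord2 _.
rewrite eps1E eps2E => k l.
have OmE : Om k l = (Om k l - a1 * ('X_k)^`M(l) - e%:R^-1 *: a2 * (t k)^`M(l))
    + a1 * ('X_k)^`M(l) + e%:R^-1 *: a2 * (t k)^`M(l) by ring.
rewrite OmE; have [u0 u1] := uE k.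
case: (ord2P l) => -> in OmE *; [rewrite u0 | rewrite u1]; rewrite bE;
  case: (ord2P k) => ->; rewrite !mderivXU /=; ring.
Qed.

Lemma equivariant_mx_free c1 c2 c3 c4 :
  inv_poly rW c1 -> inv_poly rW c2 -> inv_poly rW c3 -> inv_poly rW c4 ->
  (forall k l, c1 * ('X_k * f1^`M(l)) + c2 * ('X_k * f2^`M(l))
    + c3 * ('X_k)^`M(l) + c4 * (t k)^`M(l) = 0) ->
  [/\ c1 = 0, c2 = 0, c3 = 0 & c4 = 0].
Proof.
move=> c1W c2W c3W c4W c0.
pose eps := c1 * (\sum_i f1^`M(i) * 'X_i) + c2 * (\sum_i f2^`M(i) * 'X_i) + c3.
have epsW : inv_poly rW eps.
  by apply: inv_polyD => //; apply: inv_polyD; apply: inv_polyM => //;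
    [apply: inv_euler f1_homog | apply: inv_euler f2_homog].
(* The Euler contraction of the relation reads eps theta1 + e c4 theta2 = 0. *)
have [k|_ c4_0] := @free0 eps (e%:R *: c4) epsW (inv_polyZ _ c4W).
  have : \sum_l (c1 * ('X_k * f1^`M(l)) + c2 * ('X_k * f2^`M(l))
    + c3 * ('X_k)^`M(l) + c4 * (t k)^`M(l)) * 'X_l = 0.
    by apply: big1 => l _; rewrite c0 mul0r.
  move=> <-.
  have -> : e%:R *: c4 * t k = c4 * \sum_l (t k)^`M(l) * 'X_l.
    by rewrite (euler_dhomog (t_homog k)) -scalerAl -scalerAr.
  have eX : 'X_k = \sum_l ('X_k : S)^`M(l) * 'X_l.
    rewrite (bigD1 k) //= mderivXU eqxx mul1r big1 ?addr0 // => l lk.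
    by rewrite mderivXU eq_sym (negbTE lk) mul0r.
  rewrite /eps !mulrDl {3}eX !sum_ord2; ring.
have c40 : c4 = 0.
  by apply/eqP; move/eqP: c4_0; rewrite scaler_eq0 (negbTE e_neq0).
have X_neq0 k : 'X_k != 0 :> S.
  rewrite -linform_delta linform_eq0; apply/eqP => /rowP/(_ k); rewrite !mxE !eqxx.
  by apply/eqP; rewrite oner_eq0.
(* Off the diagonal dtheta1 contributes nothing, and ['X_k] can be cancelled. *)
have df0 l : c1 * f1^`M(l) + c2 * f2^`M(l) = 0.
  have [k kl] : exists k : 'I_2, k != l.
    by case: (ord2P l) => ->; [exists 1 | exists 0].
  apply: (mulfI (X_neq0 k)); have := c0 k l.
  rewrite c40 mderivXU (negbTE kl) mul0r !(mulr0, addr0) => <-; ring.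
have [c10 c20] := d_free invariant_comp fW df0.
split=> //; have := c0 0 0.
by rewrite c10 c20 c40 mderivXU eqxx !mul0r !add0r addr0 mulr1.
Qed.

End Coordinates.

(** * Coordinates of derivation-valued forms *)

Section FormderCoordinates.
Context {F : fieldType}.
Local Notation S := {mpoly F[2]}.
Implicit Types (om : formder F 2) (al : Defs.form F 2) (f : S) (c : 'I_2 -> S).

Lemma formder_ext om om' : (forall k, om k set0 = om' k set0) ->
  (forall k l, om k [set l] = om' k [set l]) ->
  (forall k, om k setT = om' k setT) -> om = om'.
Proof. by move=> e0 e1 eT; apply/ffunP => k; apply: form_ext. Qed.

Lemma formder_lincombE n (c : 'I_n -> S) (b : 'I_n -> formder F 2) k I :
  (\sum_i c i *: b i) k I = \sum_i c i * (b i k I : S) :> S.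
Proof.
rewrite 2!sum_ffunE; apply: eq_bigr => i _.
exact: etrans (congr1 (fun al : Defs.form F 2 => al I) (ffunE _ _)) (formZE _ _ _).
Qed.

Lemma dpoly_set0 f : dpoly f set0 = 0 :> S.
Proof.
rewrite /dpoly sum_ffunE big1 // => i _.
by apply: etrans (formZE _ _ _) _; rewrite ffunE eq_sym set1_0 mulr0.
Qed.

Lemma dpoly_setT f : dpoly f setT = 0 :> S.
Proof.
rewrite /dpoly sum_ffunE big1 // => i _.
by apply: etrans (formZE _ _ _) _; rewrite ffunE eq_sym set1T mulr0.
Qed.

Lemma xform_set1 i l : xform F i [set l] = (i == l)%:R :> S.
Proof. by rewrite ffunE (inj_eq set1_inj) eq_sym; case: eqP. Qed.

Lemma xform_set0 (i : 'I_2) : xform F i set0 = 0 :> S.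
Proof. by rewrite ffunE eq_sym set1_0. Qed.

Lemma dpoly_set1 f l : dpoly f [set l] = f^`M(l) :> S.
Proof.
rewrite /dpoly sum_ffunE (bigD1 l) //= big1 => [|i il].
  by rewrite addr0; apply: etrans (formZE _ _ _) _; rewrite xform_set1 eqxx mulr1.
by apply: etrans (formZE _ _ _) _; rewrite xform_set1 (negbTE il) mulr0.
Qed.

Lemma dform_set0 al : dform al set0 = 0.
Proof.
rewrite /dform sum_ffunE big1 // => i _.
by apply: etrans (wedge0 _ _) _; rewrite xform_set0 mul0r.
Qed.

Lemma dform_set1 al l : dform al [set l] = (al set0 : S)^`M(l).
Proof.
rewrite /dform sum_ffunE (bigD1 l) //= big1 => [|i il].
  apply: etrans (addr0 _) _; apply: etrans (wedge1 _ _ _) _.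
  by rewrite xform_set0 mul0r add0r xform_set1 eqxx mul1r ffunE.
apply: etrans (wedge1 _ _ _) _.
by rewrite xform_set0 mul0r add0r xform_set1 (negbTE il) mul0r.
Qed.

Lemma dform_setT al : (forall l, al [set l] = 0) -> dform al setT = 0.
Proof.
move=> al0; rewrite /dform sum_ffunE big1 // => i _.
apply: etrans (wedgeT _ _) _; rewrite xform_set0 mul0r add0r.
have -> : xform F i setT = 0 by rewrite ffunE eq_sym set1T.
by rewrite mul0r addr0 [X in _ * X]ffunE [X in _ - _ * X]ffunE !al0 mderiv0 !mulr0 subrr.
Qed.

Definition derivation c : formder F 2 := c 0 *: yder F 0 + c 1 *: yder F 1.

Lemma derivationE c k I :
  derivation c k I = c 0 * (yder F 0 k I : S) + c 1 * (yder F 1 k I : S) :> S.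
Proof.
have := formder_lincombE c (fun i => yder F i) k I.
by rewrite !sum_ord2.
Qed.

Lemma derivation_set0 c k : derivation c k set0 = c k.
Proof.
apply: etrans (derivationE _ _ _) _.
have yE (i : 'I_2) : yder F i k set0 = (k == i)%:R :> S.
  by rewrite ffunE; case: eqP => _; [apply: poly_form0 | rewrite ffunE].
by rewrite !yE; case: (ord2P k) => ->; rewrite /= ?mulr1 ?mulr0 ?addr0 ?add0r.
Qed.

Lemma derivation_set1 c k l : derivation c k [set l] = 0.
Proof.
apply: etrans (derivationE _ _ _) _.
have yE (i : 'I_2) : yder F i k [set l] = 0 :> S.
  by rewrite ffunE; case: eqP => _; [apply: poly_form1 | rewrite ffunE].
by rewrite !yE !mulr0 addr0.
Qed.

Lemma derivation_setT c k : derivation c k setT = 0.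
Proof.
apply: etrans (derivationE _ _ _) _.
have yE (i : 'I_2) : yder F i k setT = 0 :> S.
  by rewrite ffunE; case: eqP => _; [apply: poly_formT | rewrite ffunE].
by rewrite !yE !mulr0 addr0.
Qed.

Lemma d_mul_derivation f c k :
  [/\ form_mul (dpoly f) (derivation c) k set0 = 0,
      forall l, form_mul (dpoly f) (derivation c) k [set l] = c k * f^`M(l)
    & form_mul (dpoly f) (derivation c) k setT = 0].
Proof.
split; first 1 last.
- move=> l; apply: etrans (congr1 (fun al : Defs.form F 2 => al [set l]) (ffunE _ _)) _.
  apply: etrans (wedge1 _ _ _) _.
  by rewrite dpoly_set0 mul0r add0r dpoly_set1 derivation_set0 mulrC.
- apply: etrans (congr1 (fun al : Defs.form F 2 => al setT) (ffunE _ _)) _.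
  apply: etrans (wedgeT _ _) _.
  by rewrite dpoly_set0 dpoly_setT !derivation_set1 !mul0r !mulr0 subr0 !addr0.
apply: etrans (congr1 (fun al : Defs.form F 2 => al set0) (ffunE _ _)) _.
by apply: etrans (wedge0 _ _) _; rewrite dpoly_set0 mul0r.
Qed.

Lemma d_derivation c k :
  [/\ dder (derivation c) k set0 = 0,
      forall l, dder (derivation c) k [set l] = (c k)^`M(l)
    & dder (derivation c) k setT = 0].
Proof.
have dE I : dder (derivation c) k I = dform (derivation c k) I.
  exact: (congr1 (fun al : Defs.form F 2 => al I) (ffunE _ _)).
split=> [|l|].
- exact: etrans (dE _) (dform_set0 _).
- by apply: etrans (dE _) (etrans (dform_set1 _ _) _); rewrite derivation_set0.
by apply: etrans (dE _) (dform_setT _) => l; apply: derivation_set1.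
Qed.

Lemma d_mul_d_derivation f c k :
  [/\ form_mul (dpoly f) (dder (derivation c)) k set0 = 0,
      forall l, form_mul (dpoly f) (dder (derivation c)) k [set l] = 0
    & form_mul (dpoly f) (dder (derivation c)) k setT
        = f^`M(0) * (c k)^`M(1) - f^`M(1) * (c k)^`M(0)].
Proof.
have [d0 d1 dT] := d_derivation c k.
have mE I : form_mul (dpoly f) (dder (derivation c)) k I
    = wedge (dpoly f) (dder (derivation c) k) I.
  exact: (congr1 (fun al : Defs.form F 2 => al I) (ffunE _ _)).
split=> [|l|]; apply: etrans (mE _) _.
- by apply: etrans (wedge0 _ _) _; rewrite dpoly_set0 mul0r.
- by apply: etrans (wedge1 _ _ _) _; rewrite dpoly_set0 d0 mul0r mulr0 addr0.
apply: etrans (wedgeT _ _) _.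
by rewrite dpoly_set0 dpoly_setT !d1 !dpoly_set1 !mul0r add0r addr0.
Qed.

End FormderCoordinates.

(** * Invariance read on coefficients *)

Section InvariantFormders.
Context {C : numClosedFieldType} {gT : finGroupType} {W : {group gT}}.
Variable rW : mx_representation C W 2.
Implicit Types om : formder C 2.

Lemma inv_formder0P om : inv_formder rW 0 om <->
  [/\ forall k l, om k [set l] = 0, forall k, om k setT = 0
    & equivariant_vec rW (fun k => om k set0)].
Proof.
split=> [[om0 omW]|[om1 omT omW]].
  split=> [k l|k|g k gW].
  - by apply: om0; rewrite cards1.
  - by apply: om0; rewrite cardsT card_ord.
  by rewrite -act_formder0 (omW g gW).
split=> [k I|g gW].
  by case: (set_ord2P I) => ->; rewrite ?cards0.
apply: formder_ext => [k|k l|k].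
- by rewrite act_formder0 -omW.
- apply: etrans (act_formder1 _ _ _ _) _; rewrite om1 big1 // => j _.
  by rewrite big1 ?mulr0 // => i _; rewrite om1 rmorph0 mul0r.
apply: etrans (act_formderT _ _ _) _; rewrite omT big1 // => j _.
by rewrite omT rmorph0 mul0r mulr0.
Qed.

Lemma inv_formder1P om : inv_formder rW 1 om <->
  [/\ forall k, om k set0 = 0, forall k, om k setT = 0
    & equivariant_mx rW (fun k l => om k [set l])].
Proof.
split=> [[om0 omW]|[om1 omT omW]].
  split=> [k|k|g k l gW].
  - by apply: om0; rewrite cards0.
  - by apply: om0; rewrite cardsT card_ord.
  by rewrite -act_formder1 (omW g gW).
split=> [k I|g gW].
  by case: (set_ord2P I) => ->; rewrite ?cards1.
apply: formder_ext => [k|k l|k].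
- apply: etrans (act_formder0 _ _ _) _; rewrite om1 big1 // => j _.
  by rewrite om1 rmorph0 mulr0.
- by rewrite act_formder1 -omW.
apply: etrans (act_formderT _ _ _) _; rewrite omT big1 // => j _.
by rewrite omT rmorph0 mul0r mulr0.
Qed.

Lemma inv_formder2P om : inv_formder rW 2 om <->
  [/\ forall k, om k set0 = 0, forall k l, om k [set l] = 0
    & twisted_vec rW (fun k => om k setT)].
Proof.
split=> [[om0 omW]|[om0 om1 omW]].
  split=> [k|k l|g k gW].
  - by apply: om0; rewrite cards0.
  - by apply: om0; rewrite cards1.
  by rewrite -act_formderT (omW g gW).
split=> [k I|g gW].
  by case: (set_ord2P I) => ->; rewrite ?cardsT ?card_ord.
apply: formder_ext => [k|k l|k].
- apply: etrans (act_formder0 _ _ _) _; rewrite om0 big1 // => j _.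
  by rewrite om0 rmorph0 mulr0.
- apply: etrans (act_formder1 _ _ _ _) _; rewrite om1 big1 // => j _.
  by rewrite big1 ?mulr0 // => i _; rewrite om1 rmorph0 mul0r.
by rewrite act_formderT -omW.
Qed.

End InvariantFormders.

(** * Bases with two and four elements *)

Section ExplicitBases.
Context {S : comNzRingType} {U : lmodType S} {A : S -> Prop} {M : U -> Prop}.

Lemma is_basis_over2 (b1 b2 : U) : is_basis_over A M [:: b1; b2] <->
  [/\ M b1 /\ M b2,
      forall c1 c2, A c1 -> A c2 -> c1 *: b1 + c2 *: b2 = 0 -> c1 = 0 /\ c2 = 0
    & forall u, M u -> exists c1 c2, [/\ A c1, A c2 & u = c1 *: b1 + c2 *: b2]].
Proof.
have sumE (c : 'I_2 -> S) : \sum_(i < 2) c i *: [:: b1; b2]`_i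
    = c 0 *: b1 + c 1 *: b2 by rewrite sum_ord2.
split=> [[bM bfree bspan]|[[b1M b2M] bfree bspan]]; split.
- by split; [exact: (bM (0 : 'I_2)) | exact: (bM (1 : 'I_2))].
- move=> c1 c2 c1A c2A c0; pose c (i : 'I_2) := if i == 0 then c1 else c2.
  have cA i : A (c i) by rewrite /c; case: ifP.
  have c_eq0 := bfree c cA (etrans (sumE c) c0).
  by split; [exact: (c_eq0 0) | exact: (c_eq0 1)].
- move=> u /bspan [c [cA ->]]; exists (c (0 : 'I_2)), (c (1 : 'I_2)); split; try exact: cA.
  exact: (sumE c).
- by move=> i; case: (ord2P i) => ->.
- move=> c cA /(etrans (esym (sumE c))) /bfree[] // c0 c1 i.
  by case: (ord2P i) => ->.
move=> u /bspan [c1 [c2 [c1A c2A ->]]].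
exists (fun i : 'I_2 => if i == 0 then c1 else c2); split; last by rewrite sumE.
by move=> i; case: ifP.
Qed.

Lemma is_basis_over4 (b1 b2 b3 b4 : U) :
  [/\ M b1, M b2, M b3 & M b4] ->
  (forall c1 c2 c3 c4, A c1 -> A c2 -> A c3 -> A c4 ->
     c1 *: b1 + c2 *: b2 + c3 *: b3 + c4 *: b4 = 0 ->
     [/\ c1 = 0, c2 = 0, c3 = 0 & c4 = 0]) ->
  (forall u, M u -> exists c1 c2 c3 c4, [/\ A c1, A c2, A c3 & A c4] /\
     u = c1 *: b1 + c2 *: b2 + c3 *: b3 + c4 *: b4) ->
  is_basis_over A M [:: b1; b2; b3; b4].
Proof.
move=> [b1M b2M b3M b4M] bfree bspan.
have sumE (c : 'I_4 -> S) : \sum_(i < 4) c i *: [:: b1; b2; b3; b4]`_i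
    = c (inord 0) *: b1 + c (inord 1) *: b2 + c (inord 2) *: b3 + c (inord 3) *: b4.
  rewrite !big_ord_recl big_ord0 addr0 !addrA.
  by congr (c _ *: _ + c _ *: _ + c _ *: _ + c _ *: _); apply: val_inj;
    rewrite /= inordK.
have ord4P (P : 'I_4 -> Prop) : P (inord 0) -> P (inord 1) -> P (inord 2) ->
    P (inord 3) -> forall i, P i.
  move=> P0 P1 P2 P3 [m lt_m]; rewrite -[Ordinal _]inord_val /=.
  by case: m lt_m => [|[|[|[|]]]].
split.
- by case=> [[|[|[|[|]]]]] // lt_i.
- move=> c cA; rewrite sumE => /bfree[] // c1 c2 c3 c4.
  exact: ord4P.
move=> u /bspan [c1 [c2 [c3 [c4 [[c1A c2A c3A c4A] ->]]]]].
exists (fun i : 'I_4 => [:: c1; c2; c3; c4]`_i); split.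
  by apply: ord4P; rewrite inordK.
by rewrite sumE !inordK.
Qed.

End ExplicitBases.

(** * The bases *)

Section Bases.
Context {C : numClosedFieldType} {gT : finGroupType} {W : {group gT}}.
Variables (rW : mx_representation C W 2) (f1 f2 : {mpoly C[2]}).
Variables (t : 'I_2 -> {mpoly C[2]}) (e : nat).
Local Notation S := {mpoly C[2]}.
Local Notation x := (fun k : 'I_2 => 'X_k : S).
Hypothesis fW : mx_faithful rW.
Hypothesis ess : essential rW.
Hypothesis basic_f : basic_invariants rW [tuple f1; f2].
Hypothesis t_homog : forall k, t k \is e.-homog.
Hypothesis basis0 :
  is_basis_over (inv_poly rW) (inv_formder rW 0) [:: derivation x; derivation t].

Lemma inv_derivation c : inv_formder rW 0 (derivation c) <-> equivariant_vec rW c.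
Proof.
split=> [/inv_formder0P[_ _]|cW].
  by apply: eq_equivariant_vec => k; apply: derivation_set0.
apply/inv_formder0P; split=> [k l||].
- exact: derivation_set1.
- exact: derivation_setT.
by apply: eq_equivariant_vec cW => k; apply/esym/derivation_set0.
Qed.

Lemma lincomb2_eval (c1 c2 : S) (om1 om2 : formder C 2) k I (p1 p2 : S) :
  om1 k I = p1 -> om2 k I = p2 ->
  (c1 *: om1 + c2 *: om2) k I = c1 * p1 + c2 * p2 :> S.
Proof. by move=> <- <-; rewrite !ffunE. Qed.

Lemma lincomb4_eval (c1 c2 c3 c4 : S) (om1 om2 om3 om4 : formder C 2) k I
    (p1 p2 p3 p4 : S) :
  om1 k I = p1 -> om2 k I = p2 -> om3 k I = p3 -> om4 k I = p4 ->
  (c1 *: om1 + c2 *: om2 + c3 *: om3 + c4 *: om4) k I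
  = c1 * p1 + c2 * p2 + c3 * p3 + c4 * p4 :> S.
Proof. by move=> <- <- <- <-; rewrite !ffunE. Qed.

Lemma lincomb2_eq0 (c1 c2 : S) (om1 om2 : formder C 2) k I :
  om1 k I = 0 -> om2 k I = 0 -> (c1 *: om1 + c2 *: om2) k I = 0.
Proof.
by move=> e1 e2; apply: etrans (lincomb2_eval _ _ e1 e2) _; rewrite !mulr0 addr0.
Qed.

Lemma lincomb4_eq0 (c1 c2 c3 c4 : S) (om1 om2 om3 om4 : formder C 2) k I :
  om1 k I = 0 -> om2 k I = 0 -> om3 k I = 0 -> om4 k I = 0 ->
  (c1 *: om1 + c2 *: om2 + c3 *: om3 + c4 *: om4) k I = 0.
Proof.
move=> e1 e2 e3 e4; apply: etrans (lincomb4_eval _ _ _ _ e1 e2 e3 e4) _.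
by rewrite !mulr0 !addr0.
Qed.

Lemma formder0E k I : (0 : formder C 2) k I = 0 :> S.
Proof. by rewrite !ffunE. Qed.

Lemma f_comp p : inv_poly rW p -> exists q : S, p = q \mPo [tuple f1; f2].
Proof. by case: basic_f => _ _ f_gen /f_gen. Qed.

Lemma f_inv : inv_poly rW f1 /\ inv_poly rW f2.
Proof.
case: basic_f => _ _ f_gen; split; apply/f_gen.
  by exists 'X_0; rewrite comp_mpolyXU.
by exists 'X_1; rewrite comp_mpolyXU.
Qed.

Lemma f_homog : exists d1 d2, f1 \is d1.-homog /\ f2 \is d2.-homog.
Proof.
case: basic_f => f_homog _ _.
by have [d1 h1] := f_homog 0; have [d2 h2] := f_homog 1; exists d1, d2.
Qed.

Lemma inv_poly1 : inv_poly rW 1.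
Proof. by move=> g gW; rewrite rmorph1. Qed.

Lemma inv_poly0 : inv_poly rW 0.
Proof. by move=> g gW; rewrite rmorph0. Qed.

Lemma basis0_equivariant : equivariant_vec rW x /\ equivariant_vec rW t.
Proof.
have /is_basis_over2[[xM tM] _ _] := basis0.
by split; apply/inv_derivation.
Qed.

Lemma basis0_free c1 c2 : inv_poly rW c1 -> inv_poly rW c2 ->
  (forall k, c1 * 'X_k + c2 * t k = 0) -> c1 = 0 /\ c2 = 0.
Proof.
move=> c1W c2W c0; have /is_basis_over2[_ bfree _] := basis0.
apply: bfree => //; apply: formder_ext => [k|k l|k];
  apply: etrans _ (esym (formder0E _ _)).
- exact: etrans (lincomb2_eval _ _ (derivation_set0 x k) (derivation_set0 t k)) (c0 k).
- exact: lincomb2_eq0 (derivation_set1 x k l) (derivation_set1 t k l).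
exact: lincomb2_eq0 (derivation_setT x k) (derivation_setT t k).
Qed.

Lemma basis0_span p : equivariant_vec rW p -> exists c1 c2,
  [/\ inv_poly rW c1, inv_poly rW c2 & forall k, p k = c1 * 'X_k + c2 * t k].
Proof.
move=> /inv_derivation pM; have /is_basis_over2[_ _ bspan] := basis0.
have [c1 [c2 [c1W c2W pE]]] := bspan _ pM.
exists c1, c2; split; [exact: c1W | exact: c2W | move=> k].
apply: etrans (esym (derivation_set0 p k)) _.
apply: etrans (congr1 (fun om : formder C 2 => om k set0) pE) _.
exact: lincomb2_eval (derivation_set0 x k) (derivation_set0 t k).
Qed.

(* A basic derivation of degree 0 would be a fixed vector of W.              *)
Lemma degree_gt0 : (0 < e)%N.
Proof.
rewrite lt0n; apply/eqP => e0; pose v : 'cV[C]_2 := \col_k (t k)@_0%MM.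
have tE k : t k = (v k 0)%:MP.
  by rewrite mxE; apply: dhomog0_const; have := t_homog k; rewrite e0.
have v0 : v = 0.
  apply: ess => g gW; apply/colP => k; apply: (can_inj (@mpolyCK 2 C)).
  have [_ tW] := basis0_equivariant; rewrite -tE (tW g k gW) mxE raddf_sum /=.
  by apply: eq_bigr => j _; rewrite mpolyCM tE act_polyC.
have [|_ /eqP] := basis0_free inv_poly0 inv_poly1.
  by move=> k; rewrite tE v0 mxE mpolyC0 mulr0 mul0r addr0.
by rewrite oner_eq0.
Qed.

(** The coefficients of the four candidates are the matrices x_k df/dx_l (for both f) and the
    Jacobian matrices of theta1 and theta2, so this translates [equivariant_mx_span] and
    [equivariant_mx_free]. *)
Lemma basis1 : is_basis_over (inv_poly rW) (inv_formder rW 1)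
  [:: form_mul (dpoly f1) (derivation x); form_mul (dpoly f2) (derivation x);
      dder (derivation x); dder (derivation t)].
Proof.
have [xW tW] := basis0_equivariant; have [f1W f2W] := f_inv.
have [d1 [d2 [f1_homog f2_homog]]] := f_homog.
have mul0 f k : form_mul (dpoly f) (derivation x) k set0 = 0.
  by case: (d_mul_derivation f x k).
have mul1 f k l : form_mul (dpoly f) (derivation x) k [set l] = 'X_k * f^`M(l).
  by case: (d_mul_derivation f x k).
have mulT f k : form_mul (dpoly f) (derivation x) k setT = 0.
  by case: (d_mul_derivation f x k).
have d0 (c : 'I_2 -> S) k : dder (derivation c) k set0 = 0 by case: (d_derivation c k).
have d1' (c : 'I_2 -> S) k l : dder (derivation c) k [set l] = (c k)^`M(l).
  by case: (d_derivation c k).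
have dT (c : 'I_2 -> S) k : dder (derivation c) k setT = 0 by case: (d_derivation c k).
have fM f : inv_poly rW f -> inv_formder rW 1 (form_mul (dpoly f) (derivation x)).
  move=> fW'; apply/inv_formder1P; split; [exact: mul0 | exact: mulT |].
  apply: eq_equivariant_mx (equivariant_mx_tensor xW (invariant_1form_d fW')).
  by move=> k l; apply/esym/mul1.
have dM c : equivariant_vec rW c -> inv_formder rW 1 (dder (derivation c)).
  move=> cW; apply/inv_formder1P; split; [exact: d0 | exact: dT |].
  apply: eq_equivariant_mx (equivariant_mx_d cW).
  by move=> k l; apply/esym/d1'.
apply: is_basis_over4.
- by split; [apply: fM | apply: fM | apply: dM | apply: dM].
- move=> c1 c2 c3 c4 c1W c2W c3W c4W c0.
  apply: (equivariant_mx_free f_comp fW f1W f2W f1_homog f2_homog t_homog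
    degree_gt0 basis0_free c1W c2W c3W c4W) => k l.
  have combE := lincomb4_eval c1 c2 c3 c4 (mul1 f1 k l) (mul1 f2 k l)
    (d1' x k l) (d1' t k l).
  have comb0 := etrans (congr1 (fun om : formder C 2 => om k [set l]) c0)
    (formder0E k [set l]).
  exact: etrans (esym combE) comb0.
move=> om /inv_formder1P[om0 omT /(equivariant_mx_span f_comp fW f1W f2W
  f1_homog f2_homog t_homog degree_gt0 xW tW basis0_span)].
move=> [c1 [c2 [c3 [c4 [cW omE]]]]]; exists c1, c2, c3, c4; split; first exact: cW.
apply: formder_ext => [k|k l|k].
- apply: etrans (om0 k) (esym _).
  exact: lincomb4_eq0 (mul0 f1 k) (mul0 f2 k) (d0 x k) (d0 t k).
- apply: etrans (omE k l) (esym _).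
  exact: lincomb4_eval (mul1 f1 k l) (mul1 f2 k l) (d1' x k l) (d1' t k l).
apply: etrans (omT k) (esym _).
exact: lincomb4_eq0 (mulT f1 k) (mulT f2 k) (dT x k) (dT t k).
Qed.

(** As dtheta1 has the identity matrix, df dtheta1 has coefficient vector [h f], whose rotation is
    the gradient of f; the claim becomes the one on invariant 1-forms. *)
Lemma basis2 : is_basis_over (inv_poly rW) (inv_formder rW 2)
  [:: form_mul (dpoly f1) (dder (derivation x));
      form_mul (dpoly f2) (dder (derivation x))].
Proof.
have [f1W f2W] := f_inv.
pose h (f : S) (k : 'I_2) := if k == 0 then - f^`M(1) else f^`M(0).
have mul0 f k : form_mul (dpoly f) (dder (derivation x)) k set0 = 0.
  by case: (d_mul_d_derivation f x k).
have mul1 f k l : form_mul (dpoly f) (dder (derivation x)) k [set l] = 0.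
  by case: (d_mul_d_derivation f x k).
have mulT f k : form_mul (dpoly f) (dder (derivation x)) k setT = h f k.
  case: (d_mul_d_derivation f x k) => _ _ e'; apply: etrans e' _.
  rewrite !mderivXU /h.
  by case: (ord2P k) => -> /=; rewrite ?mulr1 ?mulr0 ?sub0r ?subr0.
have fM f : inv_poly rW f -> inv_formder rW 2 (form_mul (dpoly f) (dder (derivation x))).
  move=> fW'; apply/inv_formder2P; split; [exact: mul0 | exact: mul1 |].
  apply: (@eq_twisted_vec _ _ _ _ (h f)); first by move=> k; apply/esym/mulT.
  have hE l : rotate (h f) l = f^`M(l).
    by rewrite /rotate /h; case: (ord2P l) => -> /=; rewrite ?opprK.
  apply/twisted_rotate => g l gW; rewrite hE (invariant_1form_d fW' l gW).
  by apply: eq_bigr => i _; rewrite hE.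
apply/is_basis_over2; split; first by split; apply: fM.
- move=> c1 c2 c1W c2W c0; apply: (d_free f_comp fW) => l.
  have c0T k : c1 * h f1 k + c2 * h f2 k = 0.
    apply: etrans (esym (lincomb2_eval c1 c2 (mulT f1 k) (mulT f2 k))) _.
    exact: etrans (congr1 (fun om : formder C 2 => om k setT) c0) (formder0E _ _).
  case: (ord2P l) => ->; first exact: (c0T 1).
  by apply: oppr_inj; have := c0T 0; rewrite /h /= !mulrN -opprD oppr0.
move=> om /inv_formder2P[om0 om1 /(twisted_vec_span f_comp fW f1W f2W)].
move=> [c1 [c2 [c1W c2W omE]]].
exists c1, c2; split; [exact: c1W | exact: c2W |].
apply: formder_ext => [k|k l|k].
- by apply: etrans (om0 k) (esym _); apply: lincomb2_eq0 (mul0 f1 k) (mul0 f2 k).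
- apply: etrans (om1 k l) (esym _).
  exact: lincomb2_eq0 (mul1 f1 k l) (mul1 f2 k l).
by apply: etrans (omE k) (esym _); apply: lincomb2_eval (mulT f1 k) (mulT f2 k).
Qed.

End Bases.

Theorem theorem10p1 (R : realType) (gT : finGroupType) (W : {group gT})
    (rW : mx_representation R[i] W 2)
    (f1 f2 a b : {mpoly R[i][2]}) (e : nat) :
  reflection_group rW ->
  essential rW ->
  basic_invariants rW [tuple f1; f2] ->
  a \is e.-homog ->
  b \is e.-homog ->
  let y1 := yder R[i] (0 : 'I_2) in
  let y2 := yder R[i] (1 : 'I_2) in
  let theta1 : formder R[i] 2 := 'X_(0 : 'I_2) *: y1 + 'X_(1 : 'I_2) *: y2 in
  let theta2 : formder R[i] 2 := a *: y1 + b *: y2 in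
  is_basis_over (inv_poly rW) (inv_formder rW 0) [:: theta1; theta2] ->
  [/\ is_basis_over (inv_poly rW) (inv_formder rW 0) [:: theta1; theta2],
      is_basis_over (inv_poly rW) (inv_formder rW 1)
        [:: form_mul (dpoly f1) theta1; form_mul (dpoly f2) theta1;
            dder theta1; dder theta2]
    & is_basis_over (inv_poly rW) (inv_formder rW 2)
        [:: form_mul (dpoly f1) (dder theta1);
            form_mul (dpoly f2) (dder theta1)]].
Proof.
move=> [fW _] ess basic_f a_homog b_homog y1 y2 theta1 theta2 basis0.
pose t (k : 'I_2) := if k == 0 then a else b.
have t_homog k : t k \is e.-homog by rewrite /t; case: ifP.
split; first exact: basis0.
  exact: (@basis1 _ _ _ rW f1 f2 t e fW ess basic_f t_homog basis0).
exact: (@basis2 _ _ _ rW f1 f2 fW basic_f).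
Qed.
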